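(* Let $\eta,\nu:\mathbb{N}\to\mathbb{R}_+$ with $\nu(0)=0$ and assume there is $C>0$ such that $\eta(x)\le C(1+x)$ for all $x\in\mathbb{N}$. Let $\{X_t\}_{t\ge0}$ and $\{\tilde X_t\}_{t\ge 0}$ be two birth and death processes on $\mathbb{N}$ with the same birth rate $\eta$ and death rate $\nu$ and with marginal laws $\{P_t\}_{t\ge0}$ and $\{\tilde P_t\}_{t\ge 0}$. Assume $\kappa>-\infty$ and $\mathbb{E}[X_0^\rho+\tilde X_0^\rho]<\infty$ for some $\rho\ge1$. Then, for all $t\ge 0$, $$W_1(P_t,\tilde P_t)\le W_1(P_0,\tilde P_0)e^{-\kappa t}.$$ Moreover, if $\mathrm{Lip}(\eta)+\mathrm{Lip}(\nu)<\infty$, then there is a constant $C_\rho\in[0,\infty)$ depending only on $\rho$, which can be taken equal to $0$ if $\rho=1$ and to $1$ if $\rho\in(1,2]$, such that for all $t\ge0$ $$W_\rho^\rho(P_t,\tilde P_t)\le W_\rho^\rho(P_0,\tilde P_0)e^{-\kappa\rho t}+C_\rho(\mathrm{Lip}(\eta)+\mathrm{Lip}(\nu))\int_0^te^{\kappa\rho(r-t)}\left(W_1(P_r,\tilde P_r)+1_{\{\rho>2\}}W_{\rho-1}^{\rho-1}(P_r,\tilde P_r)\right)dr.$$ In particular, when $\rho\in(1,2]$, for all $t\ge0$, $$W_\rho^\rho(P_t,\tilde P_t)\le W_\rho^\rho(P_0,\tilde P_0)e^{-\kappa\rho t}+(\mathrm{Lip}(\eta)+\mathrm{Lip}(\nu))W_1(P_0,\tilde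 P_0)\frac{e^{-\kappa t}-e^{-\kappa\rho t}}{\kappa(\rho-1)},$$ where the last fraction is interpreted as $t$ when $\kappa=0$.
   Context: The birth and death process with rates $\eta,\nu$ is the pure jump Markov process on $\mathbb{N}=\{0,1,2,\dots\}$ with generator $Lf(x)=\eta(x)(f(x+1)-f(x))+\nu(x)(f(x-1)-f(x))$. The growth condition on $\eta$ ensures non-explosion. $\mathrm{Lip}(\eta)=\sup_{x\in\mathbb{N}}|\eta(x+1)-\eta(x)|$, $\mathrm{Lip}(\nu)=\sup_{x\in\mathbb{N}}|\nu(x+1)-\nu(x)|$, and $\kappa=\inf_{x\in\mathbb{N}}(\eta(x)+\nu(x+1)-\eta(x+1)-\nu(x))$ (the Wasserstein curvature). For $q\ge1$, $W_q(P,\tilde P)=\left(\inf_\pi\int|x-y|^q\pi(dx,dy)\right)^{1/q}$, infimum over couplings $\pi$ of $P$ and $\tilde P$. *)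

(* Defs.v *)
From HB Require Import structures.
From mathcomp Require Import all_boot all_order all_algebra.
From mathcomp Require Import all_classical all_reals all_analysis.

Set Implicit Arguments.
Unset Strict Implicit.
Unset Printing Implicit Defensive.

Import Order.TTheory GRing.Theory Num.Theory.
Import numFieldNormedType.Exports.

Local Open Scope classical_set_scope.
Local Open Scope ring_scope.

(** * Birth and death rates *)

(* The value of the last term at x = 0 is irrelevant because nu 0 = 0. *)
Definition bd_generator (R : realType) (eta nu f : nat -> R) (x : nat) : R :=
  eta x * (f x.+1 - f x) + nu x * (f x.-1 - f x).

Definition bd_lip (R : realType) (g : nat -> R) : \bar R :=
  ereal_sup (range (fun x : nat => `|g x.+1 - g x|%:E)).

Definition bd_curvature (R : realType) (eta nu : nat -> R) : \bar R :=
  ereal_inf (range (fun x : nat => (eta x + nu x.+1 - eta x.+1 - nu x)%:E)).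

(** * Markov semigroups and processes on nat *)

(* p t x A is the probability of being in A at time t when started at x;
   only the values at times t >= 0 are constrained. *)
Definition markov_semigroup (R : realType) (p : R -> R.-pker nat ~> nat) :
    Prop :=
  (forall (x : nat) (A : set nat), p 0 x A = \d_x A) /\
  (forall (s t : R) (x : nat) (A : set nat), 0 <= s -> 0 <= t ->
     p (s + t) x A = (\int[p s x]_y p t y A)%E).

(* The rates may be unbounded, so the limit defining the generator is taken
   pointwise, for every bounded test function. *)
Definition has_generator (R : realType) (p : R -> R.-pker nat ~> nat)
    (L : (nat -> R) -> nat -> R) : Prop :=
  forall (f : nat -> R) (x : nat),
    (exists M : R, forall y, `|f y| <= M) ->
    (fun h : R => (Rintegral (p h x) setT f - f x) / h) @ 0^'+ --> L f x.

(* Events determined by the process on the time interval [0, u]. *)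
Definition natural_filtration (d : measure_display) (Om : measurableType d)
    (R : realType) (P : probability Om R) (X : R -> {RV P >-> nat}) (u : R) :
    set (set Om) :=
  <<s [set E | exists (r : R) (A : set nat),
         [/\ 0 <= r, r <= u & E = X r @^-1` A]] >>.

Definition markov_process (d : measure_display) (Om : measurableType d)
    (R : realType) (P : probability Om R) (X : R -> {RV P >-> nat})
    (p : R -> R.-pker nat ~> nat) : Prop :=
  forall (u h : R) (E : set Om) (x : nat) (A : set nat), 0 <= u -> 0 <= h ->
    natural_filtration X u E ->
    P (E `&` X u @^-1` [set x] `&` X (u + h) @^-1` A) =
    (P (E `&` X u @^-1` [set x]) * p h x A)%E.

(* Right-continuous with left limits; since the state space is discrete, this
   says that the path is a step function with finitely many jumps in every
   bounded time interval. *)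
Definition pure_jump_path (R : realType) (g : R -> nat) : Prop :=
  (forall t : R, 0 <= t -> \forall s \near t^'+, g s = g t) /\
  (forall t : R, 0 < t -> exists l : nat, \forall s \near t^'-, g s = l).

(* The process is indexed by R, but only times t >= 0 play a role. *)
Definition birth_death_process (d : measure_display) (Om : measurableType d)
    (R : realType) (eta nu : nat -> R) (P : probability Om R)
    (X : R -> {RV P >-> nat}) : Prop :=
  {ae P, forall w, pure_jump_path (fun t => X t w)} /\
  exists p : R -> R.-pker nat ~> nat,
    [/\ markov_semigroup p, has_generator p (bd_generator eta nu)
      & markov_process X p].

(** * Wasserstein distances on nat *)

Definition coupling (R : realType) (P Q : probability nat R)
    (pi : probability (nat * nat)%type R) : Prop :=
  forall A : set nat, pi (fst @^-1` A) = P A /\ pi (snd @^-1` A) = Q A.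

Definition wasserstein (R : realType) (q : R) (P Q : probability nat R) :
    \bar R :=
  (ereal_inf [set (\int[pi]_z (`|z.1%:R - z.2%:R| `^ q)%:E)%E
             | pi in [set pi : probability (nat * nat)%type R
                     | coupling P Q pi]] `^ q^-1)%E.

(* Main.v *)
Require Import Defs.
From HB Require Import structures.
From mathcomp Require Import all_boot all_order all_algebra.
From mathcomp Require Import all_classical all_reals all_analysis.
From mathcomp Require Import measurable_realfun.
From mathcomp Require Import ring lra zify.
Import Order.TTheory GRing.Theory Num.Theory.
Import numFieldNormedType.Exports.
Local Open Scope classical_set_scope.
Local Open Scope ring_scope.

(* Three ingredients.  (1) On the integers a convex cost phi(|x - y|) is a
   nonnegative combination of indicators of {i < x, y <= j} and {i < y, x <= j}
   with j <= i, so the quantile (comonotone) coupling is optimal for all these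
   costs at once, and a dual pair of Kantorovich potentials can be read off the
   signs of G j - F i.  (2) Let p be a transition semigroup with the birth and
   death generator.  For bounded u, the function p_t u is left continuous in t
   and its right derivative is L p_t u, so potentials u, v evolve into
   p_t u (x) + p'_t v (y), which solves the equation of the coupled generator.
   A maximum principle, with barrier exp (M t) (1 + x + y) provided by the
   linear growth of eta, bounds it by any nonnegative supersolution S(t, |x - y|)
   with S(0, .) >= phi.  Uniqueness of the semigroup is not needed.  (3) By (1)
   and (2), W(t + h) is at most the S(h, .)-cost of the optimal coupling at
   time t.  Suitable S give the contraction of W_1 and the explicit bound for
   1 < rho <= 2; for the integral bound one restarts from the comonotone coupling
   on each step of a subdivision of [0, t] and refines the subdivision. *)

(** * Inequalities between powers *)

(** No coupled process is built: a semigroup on pairs with the coupled generator would need its own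
    existence and non-explosion theory, whereas dual potentials only see the two marginal
    semigroups. The obstacle is then regularity, since the generator is known pointwise, on bounded
    functions and for [h] decreasing to 0. Hence the potentials are finite combinations of
    indicators of initial segments, obtained from truncated costs, and the maximum principle runs
    along the half line from right derivatives and left continuity alone. The shape of [S] comes
    from a Taylor expansion. A unit jump from distance k changes k^rho by a first order term,
    controlled by the curvature, plus an excess. The total unmatched jump rate is at most L k, and k
    times the excess is at most a constant times the remainder [power_rem]. For 1 < rho <= 2 this
    remainder is k, which is itself contracted, so the equations for k^rho and k close up. For the
    integral bound the remainder only receives a crude growth rate M, and refining the subdivision
    removes the resulting factors exp (M h). *)

Section PowerInequalities.
Context {R : realType}.
Implicit Types a b s p z : R.

(** Bernoulli's inequality for exponents in [0, 1]: with z = exp u it is the convexity of exp at s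
    u, a barycentre of u and 0. *)
Lemma powR_le_tangent1 s z : 0 <= s -> s <= 1 -> 0 <= z ->
  z `^ s <= 1 + s * (z - 1).
Proof.
move=> s0 s1; rewrite le_eqVlt => /predU1P[<-|z0].
  have [->|sN0] := eqVneq s 0; first by rewrite powRr0 mul0r addr0.
  by rewrite powR0// sub0r mulrN1 subr_ge0.
rewrite /powR gt_eqF//; set u := ln z; have zE : z = expR u by rewrite lnK.
(* Tangent line of expR at s * u, evaluated at u and at 0. *)
have h1 := expR_ge1Dx (u - s * u); have h2 := expR_ge1Dx (0 - s * u).
have e0 := expR_gt0 (s * u).
have E1 : z = expR (s * u) * expR (u - s * u).
  by rewrite -expRD zE; congr expR; ring.
have E2 : 1 = expR (s * u) * expR (0 - s * u).
  by rewrite -expRD -(expR0 R); congr expR; ring.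
have -> : 1 + s * (z - 1) =
  expR (s * u) * (s * expR (u - s * u) + (1 - s) * expR (0 - s * u)).
  transitivity (s * z + (1 - s) * 1); first ring.
  by rewrite {1}E1 {2}E2; ring.
rewrite ler_pMr//; nra.
Qed.

(** This is the previous inequality with exponent 1/p, applied to z^p. *)
Lemma powR_ge_tangent1 p z : 1 <= p -> 0 <= z -> 1 + p * (z - 1) <= z `^ p.
Proof.
move=> p1 z0; have p0 : 0 < p by lra.
have pV0 : 0 <= p^-1 by rewrite invr_ge0 ltW.
have pV1 : p^-1 <= 1 by rewrite invf_le1.
have := @powR_le_tangent1 p^-1 (z `^ p) pV0 pV1 (powR_ge0 _ _).
rewrite -powRrM mulfV ?gt_eqF// powRr1//.
by rewrite -lerBlDl mulrC ler_pdivlMr// => h; lra.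
Qed.

Lemma powR_le_tangent s a b : 0 <= s -> s <= 1 -> 0 <= a -> 0 < b ->
  a `^ s <= b `^ s + s * b `^ (s - 1) * (a - b).
Proof.
move=> s0 s1 a0 b0.
have /(_ s0 s1) := @powR_le_tangent1 s (a / b).
rewrite divr_ge0 ?(ltW b0)// => /(_ isT) h.
have aE : a = b * (a / b) by rewrite mulrCA mulfV ?gt_eqF ?mulr1.
have bs := powR_gt0 s b0.
rewrite {1}aE powRM ?divr_ge0 ?(ltW b0)//.
rewrite powRB ?(gt_eqF b0) ?implybT// powRr1 ?(ltW b0)//.
apply: le_trans (ler_wpM2l (ltW bs) h) _.
by rewrite le_eqVlt; apply/orP; left; apply/eqP; field; rewrite gt_eqF.
Qed.

Lemma powR_ge_tangent p a b : 1 <= p -> 0 <= a -> 0 <= b ->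
  b `^ p + p * b `^ (p - 1) * (a - b) <= a `^ p.
Proof.
move=> p1 a0; rewrite le_eqVlt => /predU1P[<-|b0].
  have p0 : 0 < p by apply: lt_le_trans p1.
  (* At [b = 0] the slope p b^(p-1) is 1 for p = 1, by the convention 0^0 = 1, and 0 for p > 1. *)
  rewrite powR0 ?gt_eqF// add0r subr0; have [->|pN1] := eqVneq p 1.
    by rewrite subrr powRr0 powRr1// !mul1r.
  by rewrite powR0 ?subr_eq0// mulr0 mul0r powR_ge0.
have := @powR_ge_tangent1 p (a / b) p1.
rewrite divr_ge0 ?(ltW b0)// => /(_ isT) h.
have aE : a = b * (a / b) by rewrite mulrCA mulfV ?gt_eqF ?mulr1.
have bs := powR_gt0 p b0.
rewrite [leRHS](_ : _ = b `^ p * (a / b) `^ p); last first.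
  by rewrite {1}aE powRM ?divr_ge0 ?(ltW b0).
rewrite powRB ?(gt_eqF b0) ?implybT// powRr1 ?(ltW b0)//.
apply: le_trans _ (ler_wpM2l (ltW bs) h).
by rewrite le_eqVlt; apply/orP; left; apply/eqP; field; rewrite gt_eqF.
Qed.

(** For c in {a, b} the ratio c / (a + b) lies in [0, 1], hence is at most its s-th power; the two
    ratios add up to 1. *)
Lemma powR_subadditive s a b : 0 <= s -> s <= 1 -> 0 <= a -> 0 <= b ->
  (a + b) `^ s <= a `^ s + b `^ s.
Proof.
move=> s0 s1 a0; rewrite le_eqVlt => /predU1P[<-|b0].
  by rewrite addr0 lerDl powR_ge0.
have [->|aN0] := eqVneq a 0; first by rewrite add0r lerDr powR_ge0.
have {a0 aN0} a0 : 0 < a by rewrite lt_def aN0.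
have ab : 0 < a + b by rewrite addr_gt0.
suff h c : 0 < c -> c <= a + b -> (a + b) `^ s * (c / (a + b)) <= c `^ s.
  apply: le_trans (lerD (h a a0 _) (h b b0 _)); rewrite ?lerDl ?lerDr ?(ltW a0) ?(ltW b0)//.
  by rewrite -mulrDr -mulrDl mulfV ?mulr1 ?gt_eqF.
move=> c0 cab; rewrite [leRHS](_ : _ = (a + b) `^ s * (c / (a + b)) `^ s).
  by rewrite ler_wpM2l ?powR_ge0// ger1_powR// divr_gt0//= ler_pdivrMr// mul1r.
by rewrite -powRM ?divr_ge0 ?(ltW c0) ?(ltW ab)// mulrCA mulfV ?mulr1// gt_eqF.
Qed.

(** For rho = 1 a unit step leaves no excess. For rho > 2 the value comes from the second derivative
    rho (rho - 1) x^(rho-2), evaluated at some x <= k + 1 <= 2 k. *)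
Definition power_const (rho : R) : R :=
  if rho == 1 then 0 else if rho <= 2 then 1
  else rho * (rho - 1) * 2 `^ (rho - 2).

(** The sum of W_1 and of the W_(rho-1) term in the theorem, as one convex cost: a single comonotone
    coupling then computes both terms. *)
Definition power_rem (rho : R) (k : nat) : R :=
  k%:R + (if 2 < rho then k%:R `^ (rho - 1) else 0).

Lemma power_const_ge0 rho : 1 <= rho -> 0 <= power_const rho.
Proof.
move=> r1; rewrite /power_const; case: ifP => // _; case: ifPn => // _.
by rewrite !mulr_ge0 ?powR_ge0//; lra.
Qed.

Lemma power_rem_ge0 rho k : 0 <= power_rem rho k.
Proof. by rewrite /power_rem addr_ge0//; case: ifP => // _; apply: powR_ge0. Qed.

(* The excess over the first-order Taylor expansion at k is of order k^(rho-2);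
   the factor k on the left avoids this exponent, which may be negative. *)
Lemma power_taylor (rho e : R) (k : nat) : 1 <= rho -> (e == 1) || (e == -1) ->
  (0 < k)%N ->
  k%:R * ((k%:R + e) `^ rho - k%:R `^ rho - e * rho * k%:R `^ (rho - 1))
    <= power_const rho * power_rem rho k.
Proof.
move=> r1 he k0; have K1 : 1 <= k%:R :> R by rewrite ler1n.
set K : R := k%:R in K1 *; have K0 : 0 < K by lra.
have Ke0 : 0 <= K + e by case/orP: he => /eqP ->; lra.
have ee : e * e = 1 by case/orP: he => /eqP ->; ring.
have KK a : K `^ a = K * K `^ (a - 1).
  by rewrite powRB ?(gt_eqF K0) ?implybT// powRr1 ?(ltW K0)// mulrCA mulfV ?mulr1 ?gt_eqF.
rewrite /power_rem /power_const -/K.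
have [->|rN1] := eqVneq rho 1.
  by rewrite subrr powRr0 !powRr1 ?(ltW K0)//; nra.
have {r1 rN1} r1 : 1 < rho by rewrite lt_def rN1.
have [r2|r2] := leP rho 2.
  rewrite mul1r addr0 -[leRHS]mulr1 ler_pM2l//.
  have s0 : 0 <= rho - 1 by lra.
  have s1 : rho - 1 <= 1 by lra.
  have h1 := @powR_le_tangent _ _ _ s0 s1 Ke0 K0.
  have E : (K + e) `^ rho = (K + e) * (K + e) `^ (rho - 1).
    by rewrite mulr_powRB1//; lra.
  have Kr := KK rho; have Ks := KK (rho - 1).
  (* Write (K + e)^rho = K x + e x with x = (K + e)^(rho-1). Concavity bounds K x, in [h1], and
     subadditivity bounds e x; the first order terms add up to e rho K^(rho-1). *)
  have h2 : e * (K + e) `^ (rho - 1) <= e * K `^ (rho - 1) + 1.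
    case/orP: he => /eqP ee'; rewrite ee' in Ke0 *.
      have := @powR_subadditive _ K 1 s0 s1 (ltW K0) ler01.
      by rewrite powR1; lra.
    have := @powR_subadditive _ (K - 1) 1 s0 s1 Ke0 ler01.
    by rewrite subrK powR1; lra.
  rewrite E Kr; set x := (K + e) `^ (rho - 1) in h1 h2 *.
  set y := K `^ (rho - 1) in h1 h2 Ks *; set w := K `^ (rho - 1 - 1) in h1 Ks.
  have h1' : K * x <= K * y + (rho - 1) * y * e.
    rewrite (_ : (rho - 1) * y * e = K * ((rho - 1) * w * (K + e - K))); last first.
      by rewrite Ks; ring.
    by rewrite -mulrDr ler_pM2l.
  nra.
have r1' : 1 <= rho - 1 by lra.
(* The tangent at K + e rather than at K: it bounds the excess by rho e ((K + e)^(rho-1) -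
   K^(rho-1)), a difference of slopes, to which the tangent inequality for the power rho - 1
   applies. *)
have h1 := @powR_ge_tangent _ _ _ (ltW r1) (ltW K0) Ke0.
have h2 : e * ((K + e) `^ (rho - 1) - K `^ (rho - 1)) <=
    (rho - 1) * (2 `^ (rho - 2) * K `^ (rho - 2)).
  have -> : 2 = 1 + 1 :> R by lra.
  have -> : rho - (1 + 1) = rho - 1 - 1 by lra.
  case/orP: he => /eqP ee'; rewrite ee' in Ke0 *.
    have := @powR_ge_tangent _ _ _ r1' (ltW K0) Ke0.
    rewrite -powRM; [|lra..].
    have : (K + 1) `^ (rho - 1 - 1) <= ((1 + 1) * K) `^ (rho - 1 - 1).
      by apply: ge0_ler_powR; rewrite ?nnegrE//; lra.
    nra.
  have := @powR_ge_tangent _ _ _ r1' Ke0 (ltW K0).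
  have : 1 <= (1 + 1 : R) `^ (rho - 1 - 1).
    have {1}<- : (1 : R) `^ (rho - 1 - 1) = 1 by rewrite powR1.
    by apply: ge0_ler_powR; rewrite ?nnegrE//; lra.
  have : 0 <= (rho - 1) * K `^ (rho - 1 - 1) by rewrite mulr_ge0 ?powR_ge0//; lra.
  set w := K `^ (rho - 1 - 1); set c := (1 + 1) `^ _ => w0 c1.
  have := mulr_ge0 w0 (_ : 0 <= c - 1).
  rewrite subr_ge0 => /(_ c1); lra.
have E : K * K `^ (rho - 2) = K `^ (rho - 1).
  by rewrite (KK (rho - 1)); congr (_ * _ `^ _); lra.
have t0 : 0 <= rho * (rho - 1) * 2 `^ (rho - 2) * K.
  by rewrite !mulr_ge0 ?powR_ge0//; lra.
rewrite [leRHS]mulrDr -E -[leLHS]add0r lerD// [leRHS]mulrCA ler_pM2l//.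
apply: (@le_trans _ _ (rho * (e * ((K + e) `^ (rho - 1) - K `^ (rho - 1))))).
  move: h1 ee; set x := (K + e) `^ _; set y := (K + e) `^ _; nra.
rewrite -!mulrA ler_pM2l// ?mulrA; lra.
Qed.

(** The difference is at most q (k+1)^(q-1), and k (k+1)^(q-1) <= (k+1)^q <= (2k)^q. It controls the
    growth of the remainder under upward jumps, whose rate is proportional to k. *)
Lemma powR_succ_diff_le (q : R) (k : nat) : 1 <= q -> (0 < k)%N ->
  k%:R * (k.+1%:R `^ q - k%:R `^ q) <= q * 2 `^ q * k%:R `^ q.
Proof.
move=> q1 k0; have K1 : 1 <= k%:R :> R by rewrite ler1n.
rewrite -natr1; set K : R := k%:R in K1 *.
have h := @powR_ge_tangent q K (K + 1) q1.
have {h} := h ltac:(lra) ltac:(lra) => h.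
have h2 : (K + 1) `^ q <= 2 `^ q * K `^ q.
  by rewrite -powRM; [apply: ge0_ler_powR; rewrite ?nnegrE|..]; lra.
have E : (K + 1) `^ q = (K + 1) * (K + 1) `^ (q - 1).
  by rewrite mulr_powRB1; lra.
have := powR_ge0 (K + 1) (q - 1); rewrite E in h2; nra.
Qed.

Lemma powR_midconvex (q : R) (k : nat) : 1 <= q -> (0 < k)%N ->
  2 * k%:R `^ q <= k.+1%:R `^ q + k.-1%:R `^ q.
Proof.
move=> q1 k0.
have h1 := @powR_ge_tangent q k.+1%:R k%:R q1 (ler0n _ _) (ler0n _ _).
have h2 := @powR_ge_tangent q k.-1%:R k%:R q1 (ler0n _ _) (ler0n _ _).
have E : k.-1%:R = k%:R - 1 :> R by rewrite -subn1 natrB.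
rewrite -natr1 E in h1 h2 *; lra.
Qed.

End PowerInequalities.

(** * Maximum principle for the coupled generator *)

Section RightDerivatives.
Context {R : realType}.
Implicit Types (f g : R -> R) (t d : R).

Definition right_derivative f t d :=
  (fun h : R => (f (t + h) - f t) / h) @ 0^'+ --> d.

Definition left_continuous_at f t := (fun h : R => f (t - h)) @ 0^'+ --> f t.

Lemma right_derivativeD f g t d e : right_derivative f t d ->
  right_derivative g t e -> right_derivative (fun s => f s + g s) t (d + e).
Proof.
move=> fd ge; rewrite /right_derivative.
under eq_fun do rewrite opprD addrACA mulrDl.
exact: cvgD.
Qed.

Lemma right_derivativeM c f t d : right_derivative f t d ->
  right_derivative (fun s => c * f s) t (c * d).
Proof.
move=> fd; rewrite /right_derivative.
under eq_fun do rewrite -mulrBr -mulrA.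
by apply: cvgM => //; exact: cvg_cst.
Qed.

Lemma right_derivative_sum (I : Type) (r : seq I) (f : I -> R -> R) t
    (d : I -> R) : (forall i, right_derivative (f i) t (d i)) ->
  right_derivative (fun s => \sum_(i <- r) f i s) t (\sum_(i <- r) d i).
Proof.
move=> fd; elim: r => [|i r IH].
  rewrite big_nil /right_derivative.
  under eq_fun do rewrite !big_nil subrr mul0r; exact: cvg_cst.
rewrite big_cons (_ : (fun s => _) = fun s => f i s + \sum_(j <- r) f j s).
  exact: right_derivativeD.
by apply/funext => s; rewrite big_cons.
Qed.

Lemma left_continuousD f g t : left_continuous_at f t ->
  left_continuous_at g t -> left_continuous_at (fun s => f s + g s) t.
Proof. by move=> ft gt; exact: cvgD. Qed.

Lemma left_continuousM c f t : left_continuous_at f t ->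
  left_continuous_at (fun s => c * f s) t.
Proof. by move=> ft; apply: cvgM => //; exact: cvg_cst. Qed.

Lemma left_continuous_sum (I : Type) (r : seq I) (f : I -> R -> R) t :
  (forall i, left_continuous_at (f i) t) ->
  left_continuous_at (fun s => \sum_(i <- r) f i s) t.
Proof.
move=> ft; elim: r => [|i r IH].
  by rewrite /left_continuous_at; under eq_fun do rewrite big_nil;
     rewrite big_nil; exact: cvg_cst.
rewrite (_ : (fun s => _) = fun s => f i s + \sum_(j <- r) f j s).
  exact: left_continuousD.
by apply/funext => s; rewrite big_cons.
Qed.

Lemma is_derive_right f t d : is_derive t 1 f d -> right_derivative f t d.
Proof.
case=> df fE; have /cvg_dnbhs_at_right := df; rewrite -[lim _]/('D_1 f t) fE.
rewrite /right_derivative.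
have -> : (fun h => (f (t + h) - f t) / h) =
    (fun h => h^-1 *: ((f \o shift t) (h *: 1) - f t)); last by [].
by apply/funext => h; rewrite /= scaler1 [h + t]addrC /GRing.scale/= mulrC.
Qed.

Lemma is_derive_left f t d : is_derive t 1 f d -> left_continuous_at f t.
Proof.
case=> /derivable1_diffP/differentiable_continuous ft _.
rewrite /left_continuous_at; apply: cvg_at_right_filter.
apply: (@cvg_comp _ _ _ (fun h => t - h) f _ (nbhs t)); last exact: ft.
by rewrite -{2}[t]subr0; apply: cvgB; [exact: cvg_cst|exact: cvg_id].
Qed.

(** A right derivative gives right continuity, which settles f t < 0; at a zero the sign must come
    from the derivative, and strictness there is what the barrier of the maximum principle
    supplies. *)
Lemma right_derivative_le0 f t d : right_derivative f t d -> f t <= 0 ->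
  (f t = 0 -> d < 0) -> \forall h \near 0^'+, f (t + h) <= 0.
Proof.
move=> fd; rewrite le_eqVlt => /predU1P[ft0 /(_ ft0) d0|ft _].
  near=> h; have : (f (t + h) - f t) / h < 0 by near: h; exact: cvgr_lt fd _ d0.
  rewrite ft0 subr0 ltr_pdivrMr// mul0r; exact: ltW.
have d1 : d < `|d| + 1 by rewrite (le_lt_trans (ler_norm d))// ltrDl.
near=> h; have : (f (t + h) - f t) / h < `|d| + 1.
  by near: h; exact: cvgr_lt fd _ d1.
rewrite ltr_pdivrMr// ltrBlDr => /ltW/le_trans; apply.
rewrite -lerBrDr sub0r -ler_pdivlMl//.
near: h; apply: nbhs_right_le; rewrite mulr_gt0 ?oppr_gt0 ?invr_gt0//.
Unshelve. all: by end_near. Qed.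

(** Let tau be the supremum of the times up to which [P] holds. The closure step gives [P tau], and
    the local step then carries [P] beyond tau, a contradiction. *)
Lemma real_induction (P : R -> Prop) : P 0 ->
  (forall t, 0 <= t -> (forall s, 0 <= s <= t -> P s) ->
    \forall h \near 0^'+, P (t + h)) ->
  (forall t, 0 < t -> (forall s, 0 <= s < t -> P s) -> P t) ->
  forall t, 0 <= t -> P t.
Proof.
move=> P0 Pr Pl T T0; apply: contrapT => PT.
pose A := [set t | 0 <= t /\ forall s, 0 <= s <= t -> P s].
have A0 : A 0 by split=> // s; rewrite -eq_le => /eqP <-.
have AT : ubound A T.
  move=> t [t0 At]; rewrite leNgt; apply/negP => Tt.
  by apply: PT; apply: At; rewrite T0 ltW.
have sA : has_sup A by split; [exists 0|exists T].
pose tau := sup A; have tau0 : 0 <= tau by exact: (ub_le_sup sA.2).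
have Plt s : 0 <= s < tau -> P s.
  case/andP=> s0 /(sup_gt sA.1)[a [_ Aa] sa].
  by apply: Aa; rewrite s0 ltW.
have Ptau : P tau.
  by have [<-//|tau_gt0] := eqVneq 0 tau; apply: Pl; rewrite // lt_def eq_sym tau_gt0.
have Ple s : 0 <= s <= tau -> P s.
  case/andP=> s0; rewrite le_eqVlt => /predU1P[->//|st].
  by apply: Plt; rewrite s0.
have /nbhs_ballP[e /= e0 eP] := Pr _ tau0 Ple.
suff: A (tau + e / 2).
  by move/(ub_le_sup sA.2); rewrite gerDl leNgt divr_gt0.
split=> [|s /andP[s0 se]]; first by rewrite addr_ge0// divr_ge0// ltW.
have [st|ts] := leP s tau; first by apply: Ple; rewrite s0.
rewrite -(subrKC tau s); apply: eP; last by rewrite subr_gt0.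
rewrite /ball/= sub0r normrN gtr0_norm ?subr_gt0// ltrBlDl (le_lt_trans se)//.
by rewrite ltrD2l ltr_pdivrMr// mulr_natr mulr2n ltrDl.
Qed.

End RightDerivatives.

Section CoupledGenerator.
Context {R : realType}.
Variables (eta nu : nat -> R).
Hypotheses (eta0 : forall x, 0 <= eta x) (nu0 : forall x, 0 <= nu x).

(* Both coordinates jump together as often as their marginal rates permit. *)
Definition coupled_generator (f : nat -> nat -> R) (x y : nat) : R :=
  let b := Num.min (eta x) (eta y) in let m := Num.min (nu x) (nu y) in
  b * (f x.+1 y.+1 - f x y) + (eta x - b) * (f x.+1 y - f x y)
  + (eta y - b) * (f x y.+1 - f x y)
  + m * (f x.-1 y.-1 - f x y) + (nu x - m) * (f x.-1 y - f x y)
  + (nu y - m) * (f x y.-1 - f x y).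

Lemma coupled_generator_marginals (u v : nat -> R) x y :
  coupled_generator (fun x y => u x + v y) x y =
  bd_generator eta nu u x + bd_generator eta nu v y.
Proof. by rewrite /coupled_generator /bd_generator/=; ring. Qed.

Lemma coupled_generatorB f g x y :
  coupled_generator (fun x y => f x y - g x y) x y =
  coupled_generator f x y - coupled_generator g x y.
Proof. by rewrite /coupled_generator/=; ring. Qed.

(** At a maximum with value 0 the six increments are nonpositive, and the six jump rates are
    nonnegative. *)
Lemma coupled_generator_max f x y : (forall x y, f x y <= 0) -> f x y = 0 ->
  coupled_generator f x y <= 0.
Proof.
move=> f0 fxy; rewrite /coupled_generator/= fxy !subr0.
have mx (a b : R) : 0 <= a - Num.min a b by rewrite subr_ge0 ge_min lexx.
have my (a b : R) : 0 <= b - Num.min a b by rewrite subr_ge0 ge_min lexx orbT.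
have m0 (a b : R) : 0 <= a -> 0 <= b -> 0 <= Num.min a b.
  by move=> a0 b0; rewrite le_min a0.
by rewrite -!oppr_ge0 !opprD !addr_ge0// -mulrN mulr_ge0 ?oppr_ge0 ?mx ?my ?m0.
Qed.

(** As [Z] is bounded above uniformly in time, eps times the barrier exceeds it outside a finite
    square of states. Inside, finitely many right derivatives have to be controlled, so one right
    neighbourhood of [t] serves all states. *)
Lemma coupled_maximum_principle (C : R) (Z D : R -> nat -> nat -> R) :
  0 < C -> (forall x, eta x <= C * (1 + x%:R)) ->
  (exists B : R, forall (t : R) x y, 0 <= t -> Z t x y <= B) ->
  (forall (t : R) x y, 0 <= t -> right_derivative (fun s => Z s x y) t (D t x y)) ->
  (forall (t : R) x y, 0 < t -> left_continuous_at (fun s => Z s x y) t) ->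
  (forall (t : R) x y, 0 <= t -> D t x y <= coupled_generator (Z t) x y) ->
  (forall x y, Z 0 x y <= 0) ->
  forall (t : R) x y, 0 <= t -> Z t x y <= 0.
Proof.
move=> C0 etaC [B ZB] Zr Zl DZ Z0.
(* The coupled generator of [V] is at most C (1 + x) + C (1 + y) <= 2 C V; the extra 1 makes the
   comparison with [M * V] strict. *)
pose M := 2 * C + 1; pose V (x y : nat) : R := 1 + x%:R + y%:R.
have V0 x y : 0 < V x y.
  by rewrite /V -addrA -natrD -(natrD _ 1%N) ltr0n.
suff main (eps : R) : 0 < eps -> forall t : R, 0 <= t ->
    forall x y, Z t x y - eps * (expR (M * t) * V x y) <= 0.
  move=> t x y t0; apply/ler_addgt0Pr => e e0; rewrite add0r.
  have c0 : 0 < expR (M * t) * V x y by rewrite mulr_gt0 ?expR_gt0.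
  have := main (e / (expR (M * t) * V x y)) (divr_gt0 e0 c0) t t0 x y.
  by rewrite divfK ?gt_eqF// subr_le0.
move=> eps0; pose z (t : R) x y := Z t x y - eps * (expR (M * t) * V x y).
have bder (t : R) x y : is_derive t 1 (fun s => - (eps * (expR (M * s) * V x y)))
    (- (eps * (M * expR (M * t) * V x y))).
  apply: is_derive_eq; rewrite /GRing.scale/=; ring.
have zr (t : R) x y : 0 <= t -> right_derivative (fun s => z s x y) t
    (D t x y - eps * (M * expR (M * t) * V x y)).
  by move=> t0; apply: right_derivativeD; [exact: Zr|exact: is_derive_right].
have zl (t : R) x y : 0 < t -> left_continuous_at (fun s => z s x y) t.
  by move=> t0; apply: left_continuousD; [exact: Zl|exact: is_derive_left].
apply: real_induction.
- move=> x y; rewrite subr_le0 mulr0 expR0 mul1r (le_trans (Z0 _ _))//.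
  by rewrite mulr_ge0 ?ltW.
- move=> t t0 zs; have zt x y : z t x y <= 0 by apply: zs; rewrite t0 lexx.
  (* Where x >= n or y >= n, the barrier is at least eps n >= B at every later time. *)
  have [n nB] : exists n : nat, B <= eps * n%:R.
    exists (Num.truncn (B / eps)).+1.
    by rewrite -ler_pdivrMl// mulrC ltW// truncnS_gt.
  have small (ij : 'I_n * 'I_n) : \forall h \near 0^'+, z (t + h) ij.1 ij.2 <= 0.
    apply: (right_derivative_le0 _ _ _ (zr _ _ _ t0)); first exact: zt.
    move=> z0; have zmax := @coupled_generator_max (z t) ij.1 ij.2 zt z0.
    rewrite coupled_generatorB subr_le0 in zmax.
    have := le_trans (DZ t ij.1 ij.2 t0) zmax.
    rewrite subr_lt0 => /le_lt_trans; apply.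
    have -> : coupled_generator (fun x y => eps * (expR (M * t) * V x y))
        ij.1 ij.2 = eps * (expR (M * t) * coupled_generator V ij.1 ij.2).
      by rewrite /coupled_generator; ring.
    rewrite ltr_pM2l// mulrC [ltRHS]mulrAC ltr_pM2r ?expR_gt0//.
    rewrite (coupled_generator_marginals (fun x => 1 + x%:R) (fun y => y%:R)).
    have Lle x c : bd_generator eta nu (fun x => c + x%:R) x <= C * (1 + x%:R).
      rewrite /bd_generator (le_trans _ (etaC x))// -natr1.
      have : (x.-1%:R : R) <= x%:R by rewrite ler_nat leq_pred.
      have := nu0 x; set p : R := x.-1%:R; set q : R := x%:R; nra.
    have h1 := Lle ij.1 1; have h2 := Lle ij.2 0.
    rewrite (_ : (fun y : nat => y%:R) = (fun y : nat => 0 + y%:R) :> (nat -> R));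
      last by apply/funext => y; rewrite add0r.
    apply: le_lt_trans (lerD h1 h2) _.
    rewrite /M /V; have := ler0n R ij.1; have := ler0n R ij.2; nra.
  near=> h => x y.
  have zh (ij : 'I_n * 'I_n) : z (t + h) ij.1 ij.2 <= 0.
    by move: ij; near: h; exact: filter_forall small.
  have [xyn|] := boolP ((x < n)%N && (y < n)%N).
    by case/andP: xyn => xn yn; exact: (zh (Ordinal xn, Ordinal yn)).
  rewrite negb_and -!leqNgt => nxy.
  rewrite subr_le0; have th0 : 0 <= t + h by rewrite addr_ge0.
  apply: (le_trans (ZB _ _ _ th0)); apply: (le_trans nB).
  rewrite ler_pM2l// (@le_trans _ _ (1 * V x y))//.
    rewrite mul1r /V -addrA -natrD -(natrD _ 1%N) ler_nat; lia.
  rewrite ler_wpM2r ?(ltW (V0 _ _))// (le_trans _ (expR_ge1Dx _))// lerDl.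
  by rewrite mulr_ge0// /M; lra.
(* By left continuity a positive value at [t] would persist at some earlier time [t - h]. *)
- move=> t t0 zt x y; rewrite leNgt; apply/negP => zxy.
  suff : \forall h \near (0:R)^'+, False by move/filter_ex => [].
  near=> h.
  have : 0 < z (t - h) x y by near: h; exact: cvgr_gt (zl t x y t0) _ zxy.
  rewrite ltNge => /negP; apply; apply: zt; rewrite subr_ge0 gtrBl; apply/andP; split=> //.
  by near: h; exact: nbhs_right_le.
Unshelve. all: by end_near. Qed.

End CoupledGenerator.

(** * Coupled generator of functions of the distance *)

Definition dist_nat (x y : nat) : nat := (x - y + (y - x))%N.

Lemma dist_natC x y : dist_nat x y = dist_nat y x.
Proof. by rewrite /dist_nat addnC. Qed.

Section CoupledDistance.
Context {R : realType}.
Variables (eta nu : nat -> R) (kappa : R).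
Hypothesis nu0 : forall x, 0 <= nu x.
Hypothesis nu00 : nu 0%N = 0.
Hypothesis curv : forall x, kappa <= eta x + nu x.+1 - eta x.+1 - nu x.

Lemma coupled_generator_sym (f : nat -> nat -> R) x y :
  (forall x y, f x y = f y x) ->
  coupled_generator eta nu f x y = coupled_generator eta nu f y x.
Proof.
move=> fC; rewrite /coupled_generator/= (fC x.+1 y.+1) (fC x.+1 y) (fC x y.+1).
rewrite (fC x.-1 y.-1) (fC x.-1 y) (fC x y.-1) (fC x y).
by rewrite (minC (eta y)) (minC (nu y)); ring.
Qed.

Lemma curvature_increment y k :
  eta (y + k)%N - eta y - (nu (y + k)%N - nu y) <= - kappa * k%:R.
Proof.
elim: k => [|k IH]; first by rewrite addn0 !subrr mulr0.
by have := curv (y + k); rewrite addnS -natr1; lra.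
Qed.

Lemma lipschitz_increment (g : nat -> R) l y k :
  (forall x, `|g x.+1 - g x| <= l) -> `|g (y + k)%N - g y| <= l * k%:R.
Proof.
move=> gl; elim: k => [|k IH]; first by rewrite addn0 subrr normr0 mulr0.
rewrite addnS -natr1 mulrDr mulr1 -(subrKA (g (y + k)%N)) addrC.
by rewrite (le_trans (ler_normD _ _))// lerD.
Qed.

(* The coupled distance is itself a birth and death chain. *)
Lemma coupled_generator_dist x y : exists up dn : R,
  [/\ 0 <= up /\ 0 <= dn, dist_nat x y = 0%N -> dn = 0, up - dn <= - kappa * (dist_nat x y)%:R,
    (forall l m : R, (forall x, `|eta x.+1 - eta x| <= l) ->
      (forall x, `|nu x.+1 - nu x| <= m) ->
      up + dn <= (l + m) * (dist_nat x y)%:R) &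
    forall g : nat -> R,
      coupled_generator eta nu (fun x y => g (dist_nat x y)) x y =
      up * (g (dist_nat x y).+1 - g (dist_nat x y)) +
      dn * (g (dist_nat x y).-1 - g (dist_nat x y))].
Proof.
wlog : x y / (y <= x)%N => [wl|].
  have [/wl//|/ltnW/wl [up [dn [? ? ? ? H3]]]] := leqP y x.
  exists up, dn; rewrite dist_natC; split=> // g.
  by rewrite coupled_generator_sym => [|? ?]; [exact: H3|rewrite dist_natC].
rewrite leq_eqVlt => /predU1P[->|yx].
  exists 0, 0; have -> : dist_nat x x = 0%N by rewrite /dist_nat subnn.
  rewrite !mulr0 !subr0 addr0; split=> // [l m _ _|g]; first by rewrite mulr0.
  rewrite /coupled_generator !minxx !subrr /dist_nat !subnn; ring.
pose k := (x - y)%N; have k0 : (0 < k)%N by rewrite subn_gt0.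
have xE : x = (y + k)%N by rewrite subnKC// ltnW.
have dE : dist_nat x y = k by rewrite /dist_nat /k; lia.
pose be := Num.min (eta x) (eta y); pose mn := Num.min (nu x) (nu y).
have lx (a b : R) : 0 <= a - Num.min a b by rewrite subr_ge0 ge_min lexx.
have ly (a b : R) : 0 <= b - Num.min a b by rewrite subr_ge0 ge_min lexx orbT.
have abs (a b : R) : a - Num.min a b + (b - Num.min a b) = `|a - b|.
  have [ab|ab] := leP a b.
    by rewrite subrr add0r ler0_norm ?opprB// subr_le0.
  by rewrite subrr addr0 gtr0_norm// subr_gt0.
(* With [y < x], the distance grows at an unmatched birth from [x] or an unmatched death from [y],
   and shrinks in the two opposite cases; matched jumps preserve it. *)
exists (eta x - be + (nu y - mn)), (eta y - be + (nu x - mn)); rewrite dE.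
split.
- by split; apply: addr_ge0; rewrite ?lx ?ly.
- by move=> k00; rewrite k00 in k0.
- by have := curvature_increment y k; rewrite -xE; lra.
- move=> l m hl hm; have := lipschitz_increment eta l y k hl.
  have := lipschitz_increment nu m y k hm; rewrite -xE -!abs -/be -/mn; lra.
move=> g; rewrite /coupled_generator -/be -/mn dE.
have -> : dist_nat x.+1 y.+1 = k by rewrite /dist_nat /k; lia.
have -> : dist_nat x.+1 y = k.+1 by rewrite /dist_nat /k; lia.
have -> : dist_nat x y.+1 = k.-1 by rewrite /dist_nat /k; lia.
have -> : dist_nat x.-1 y = k.-1 by rewrite /dist_nat /k; lia.
(* At y = 0 the predecessor of y is y itself, so a matched death would change the distance; its rate
   is 0 because [nu 0] is 0. *)
have [y0|y0] := posnP y.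
  have mn0 : mn = 0 by rewrite /mn y0 nu00; apply/min_idPr.
  by rewrite mn0 y0 nu00/=; ring.
have -> : dist_nat x.-1 y.-1 = k by rewrite /dist_nat /k; lia.
have -> : dist_nat x y.-1 = k.+1 by rewrite /dist_nat /k; lia.
by ring.
Qed.

Lemma coupled_generator_dist1 x y :
  coupled_generator eta nu (fun x y => (dist_nat x y)%:R) x y
    <= - kappa * (dist_nat x y)%:R.
Proof.
have [up [dn [_ dn0 H _ ->]]] := coupled_generator_dist x y.
(* At distance 0 a downward jump changes nothing, as the predecessor of 0 is 0, while the drift
   bound subtracts [dn]; there [dn] is 0. *)
apply: le_trans H; case: (dist_nat x y) dn0 => [->//|k _].
  by rewrite mul0r !subr0 addr0 mulr1.
by rewrite /= -natr1; lra.
Qed.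

Variable L : R.
Hypothesis lipL : exists l m : R, [/\ forall x, `|eta x.+1 - eta x| <= l,
  forall x, `|nu x.+1 - nu x| <= m & l + m = L].

Let L0 : 0 <= L.
Proof.
have [l [m [hl hm <-]]] := lipL.
by rewrite addr_ge0// (le_trans _ (hl 0%N), le_trans _ (hm 0%N)).
Qed.

(** Expand at distance k for the jumps +1 and -1. The first order terms carry the drift [up - dn],
    bounded by the curvature; the excesses carry the total rate [up + dn], at most L k. Both sides
    are multiplied by k so that [power_taylor] applies, and this factor is the k of the total
    rate. *)
Lemma coupled_generator_power rho x y : 1 <= rho ->
  coupled_generator eta nu (fun x y => (dist_nat x y)%:R `^ rho) x y <=
  - kappa * rho * (dist_nat x y)%:R `^ rho
  + power_const rho * L * power_rem rho (dist_nat x y).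
Proof.
move=> r1; have rn0 : rho != 0 by rewrite gt_eqF// (lt_le_trans _ r1).
have [up [dn [[up0 dn0] _ H1 H2 H3]]] := coupled_generator_dist x y.
rewrite (H3 (fun k => k%:R `^ rho)) {H3}.
have [l [m [hl hm lmE]]] := lipL.
have {H2} := H2 l m hl hm; rewrite lmE.
move: (dist_nat x y) H1 => k H1 H2.
have C0 := power_const_ge0 rho r1; have rem0 := power_rem_ge0 rho k.
have [k0|k0] := posnP k.
  rewrite k0 mulr0 in H1 H2.
  have [-> ->] : up = 0 /\ dn = 0 by split; lra.
  by rewrite k0 powR0// mulr0 !mul0r !add0r -k0 !mulr_ge0.
have K0 : 0 < k%:R :> R by rewrite ltr0n.
have T1 := @power_taylor _ rho 1 k r1; rewrite eqxx/= in T1.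
have {T1} T1 := T1 isT k0.
have T2 := @power_taylor _ rho (-1) k r1; rewrite eqxx orbT in T2.
have {T2} T2 := T2 isT k0.
have -> : k.-1%:R = k%:R - 1 :> R by rewrite -subn1 natrB.
rewrite -natr1.
have Kr : k%:R * k%:R `^ (rho - 1) = k%:R `^ rho :> R.
  by rewrite mulr_powRB1// (lt_le_trans _ r1).
have P0 := powR_ge0 (k%:R : R) (rho - 1).
set K : R := k%:R in K0 Kr P0 H1 H2 T1 T2 *.
set e := power_const rho * power_rem rho k in T1 T2.
have e0 : 0 <= e by rewrite mulr_ge0.
rewrite -(ler_pM2l K0).
have -> : power_const rho * L * power_rem rho k = L * e by rewrite /e; ring.
set A := (K + 1) `^ rho in T1 *; set B := (K - 1) `^ rho in T2 *.
set p := K `^ rho in T1 T2 Kr *; set q := K `^ (rho - 1) in T1 T2 P0 Kr.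
apply: (@le_trans _ _ (up * (e + K * (rho * q)) + dn * (e - K * (rho * q)))).
  rewrite mulrDr lerD// mulrCA ler_wpM2l//; lra.
rewrite -Kr.
have h1 : (up + dn) * e <= L * K * e by rewrite ler_wpM2r.
have h2 : (up - dn) * (K * (rho * q)) <= - kappa * K * (K * (rho * q)).
  rewrite ler_wpM2r// mulr_ge0 ?(ltW K0)// mulr_ge0//.
  by rewrite (le_trans _ r1).
lra.
Qed.

(** The first summand dominates both -kappa, the growth rate of k, and -kappa rho; the second is L
    times the constant of [powR_succ_diff_le] at exponent rho - 1. *)
Definition rem_growth (rho : R) : R :=
  `|kappa| * rho + L * ((rho - 1) * 2 `^ (rho - 1)).

Lemma rem_growth_ge rho : 1 <= rho -> - kappa * rho <= rem_growth rho.
Proof.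
move=> r1; apply: (@le_trans _ _ (`|kappa| * rho)).
  rewrite ler_wpM2r ?(le_trans _ r1)//.
  by rewrite (le_trans (ler_norm _))// normrN.
by rewrite lerDl !mulr_ge0 ?powR_ge0// subr_ge0.
Qed.

(** A crude estimate suffices, since its rate disappears when the subdivision is refined: in the
    power term, downward jumps are dropped and the upward rate is bounded by L k. *)
Lemma coupled_generator_rem rho x y : 1 <= rho ->
  coupled_generator eta nu (fun x y => power_rem rho (dist_nat x y)) x y
    <= rem_growth rho * power_rem rho (dist_nat x y).
Proof.
move=> r1; have [up [dn [[up0 dn0] _ H1 H2 H3]]] := coupled_generator_dist x y.
rewrite H3 {H3}.
have [l [m [hl hm lmE]]] := lipL.
have {H2} := H2 l m hl hm; rewrite lmE.
move: (dist_nat x y) H1 => k H1 H2.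
have kr : - kappa * k%:R <= rem_growth rho * k%:R.
  rewrite ler_wpM2r// (@le_trans _ _ (`|kappa| * 1))//.
    by rewrite mulr1 (le_trans (ler_norm _))// normrN.
  rewrite /rem_growth -[leLHS]addr0 lerD ?ler_wpM2l//.
  by rewrite !mulr_ge0 ?powR_ge0// subr_ge0.
have [k0|k0] := posnP k.
  rewrite k0 mulr0 in H1 H2.
  have [-> ->] : up = 0 /\ dn = 0 by split; lra.
  rewrite !mul0r addr0 mulr_ge0 ?power_rem_ge0//.
  by rewrite addr_ge0 ?mulr_ge0 ?powR_ge0 ?subr_ge0// (le_trans _ r1).
have h1 : up * (k.+1%:R - k%:R) + dn * (k.-1%:R - k%:R) <= rem_growth rho * k%:R.
  apply: le_trans kr; apply: le_trans H1.
  by rewrite -[k.-1]subn1 natrB// -natr1; lra.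
rewrite /power_rem; case: ifPn => r2; last by rewrite !addr0.
have q1 : 1 <= rho - 1 by lra.
rewrite mulrDr; set p := _ `^ (rho - 1); set q := _ `^ _; set s := _ `^ _.
suff h2 : up * (p - q) + dn * (s - q) <= rem_growth rho * q by lra.
have sq : dn * (s - q) <= 0.
  rewrite mulr_ge0_le0// subr_le0 ge0_ler_powR ?nnegrE//; first lra.
  by rewrite ler_nat leq_pred.
have K0 : 0 < k%:R :> R by rewrite ltr0n.
have pq : q <= p by rewrite ge0_ler_powR ?nnegrE//; [lra|rewrite ler_nat].
apply: (@le_trans _ _ (L * k%:R * (p - q))).
  rewrite -[leRHS]addr0 lerD// ler_wpM2r ?subr_ge0//.
  by rewrite (le_trans _ H2)// lerDl.
have := powR_succ_diff_le _ _ q1 k0; rewrite -/p -/q => h.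
rewrite -mulrA (le_trans (ler_wpM2l L0 h))// mulrA.
rewrite ler_wpM2r ?powR_ge0// /rem_growth lerDr mulr_ge0//.
by rewrite (le_trans _ r1).
Qed.

End CoupledDistance.

(** * Transition kernels and marginal laws *)

Lemma measurable_nat (A : set nat) : measurable A. Proof. by []. Qed.

Lemma measurable_nat_fun d (T : sigmaRingType d) D (f : nat -> T) :
  measurable_fun D f.
Proof. by move=> mD B _; exact: measurable_nat. Qed.

Lemma measurable_natnat (A : set (nat * nat)) : measurable A.
Proof.
have -> : A = \bigcup_i \bigcup_j
    ((if (i, j) \in A then [set i] else set0) `*` [set j]).
  apply/seteqP; split=> [[i j] Aij|[i j] [i' _ [j' _]]] /=.
    by exists i => //; exists j => //; rewrite mem_set.
  by case: ifPn => [|_ []//]; rewrite inE => Aij [-> ->].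
apply: bigcup_measurable => i _; apply: bigcup_measurable => j _.
by apply: measurableX; exact: measurable_nat.
Qed.

Lemma measurable_natnat_fun d (T : sigmaRingType d) D
  (f : nat * nat -> T) : measurable_fun D f.
Proof. by move=> mD B _; exact: measurable_natnat. Qed.

Section Kernel.
Context {R : realType} (p : R -> R.-pker nat ~> nat).

Definition transition (A : set nat) (t : R) (x : nat) : R := fine (p t x A).

Lemma transitionE A t x : p t x A = (transition A t x)%:E.
Proof. by rewrite /transition fineK//; exact: finite_kernel_measure. Qed.

Lemma transition_ge0 A t x : 0 <= transition A t x.
Proof. by rewrite fine_ge0. Qed.

Lemma transition_le1 A t x : transition A t x <= 1.
Proof.
rewrite -lee_fin -transitionE -(@prob_kernel _ _ _ _ _ (p t) x).
by apply: le_measure; rewrite ?inE.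
Qed.

Lemma transitionC A t x : transition (~` A) t x = 1 - transition A t x.
Proof.
apply/eqP; rewrite -subr_eq0 opprB addrA subr_eq0 -eqe EFinD -!transitionE.
rewrite -measureU ?setICl// setUC setUv.
by apply/eqP; exact: prob_kernel.
Qed.

Variables (eta nu : nat -> R).
Hypothesis pS : markov_semigroup p.
Hypothesis pG : has_generator p (bd_generator eta nu).

Lemma transition0 A x : transition A 0 x = (x \in A)%:R.
Proof. by rewrite /transition pS.1 diracE. Qed.

(** The backward equation: p_(t+h) = p_h p_t, with the small time acting last, so the generator
    applies to the bounded function p_t 1_A. *)
Lemma transition_right_derivative A t x : 0 <= t ->
  right_derivative (fun s => transition A s x) t
    (bd_generator eta nu (transition A t) x).
Proof.
move=> t0; have Abd : exists M : R, forall y, `|transition A t y| <= M.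
  by exists 1 => y; rewrite ger0_norm ?transition_ge0 ?transition_le1.
apply: cvg_trans (pG (transition A t) x Abd).
apply: near_eq_cvg; near=> h.
congr ((_ - _) / _); rewrite /Rintegral /transition addrC pS.2//.
by under eq_integral do rewrite -transitionE.
Unshelve. all: by end_near. Qed.

(** A right derivative at 0 forces right continuity at 0: the semigroup is standard. *)
Lemma transition_stay x : (fun h => transition [set x] h x) @ 0^'+ --> (1 : R).
Proof.
have d := transition_right_derivative [set x] 0 x (lexx 0).
have e : (fun h : R => h) @ 0^'+ --> (0 : R).
  by apply: cvg_at_right_filter; exact: cvg_id.
have : (fun h => (transition [set x] (0 + h) x - transition [set x] 0 x) / h
    * h + 1) @ 0^'+ --> bd_generator eta nu (transition [set x] 0) x * 0 + 1.
  by apply: cvgD; [exact: cvgM|exact: cvg_cst].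
rewrite mulr0 add0r; apply: cvg_trans.
apply: near_eq_cvg; near=> h => /=.
by rewrite add0r transition0 mem_set// divfK ?subrK// gt_eqF.
Unshelve. all: by end_near. Qed.

(** Keep the contribution of being at [x] after time [h], and use a b >= a - (1 - b) for a, b in
    [0, 1]. *)
Lemma transition_lb A s h x : 0 <= s -> 0 <= h ->
  transition A s x - (1 - transition [set x] h x) <= transition A (h + s) x.
Proof.
move=> s0 h0.
apply: (@le_trans _ _ (transition [set x] h x * transition A s x)).
  have := transition_le1 A s x; have := transition_le1 [set x] h x; nra.
rewrite -lee_fin -transitionE pS.2// EFinM -!transitionE.
rewrite muleC -integral_cst//.
apply: (@le_trans _ _ (\int[p h x]_(y in [set x]) p s y A)%E).
  by rewrite le_eqVlt; apply/orP; left; apply/eqP; apply: eq_integral => y;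
     rewrite inE => ->.
apply: ge0_subset_integral => //; exact: measurable_nat_fun.
Qed.

(** The lower bound with [s = t - h], applied to [A] and to its complement, encloses the value at
    [t - h] between two quantities converging to the value at [t]. *)
Lemma transition_left_continuous A t x : 0 < t ->
  left_continuous_at (fun s => transition A s x) t.
Proof.
move=> t0.
have H : (fun h : R => 1 - transition [set x] h x) @ 0^'+ --> (1 - 1 : R).
  by apply: cvgB; [exact: cvg_cst|exact: transition_stay].
have E : (fun h : R => transition A t x - (1 - transition [set x] h x)) @ 0^'+
    --> transition A t x - (1 - 1).
  by apply: cvgB => //; exact: cvg_cst.
have F : (fun h : R => transition A t x + (1 - transition [set x] h x)) @ 0^'+
    --> transition A t x + (1 - 1).
  by apply: cvgD => //; exact: cvg_cst.
rewrite subrr subr0 in E; rewrite subrr addr0 in F.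
apply: squeeze_cvgr E F; near=> h.
have h0 : 0 <= h by [].
have ht : 0 <= t - h.
  by rewrite subr_ge0; near: h; exact: nbhs_right_le.
have := transition_lb A _ _ x ht h0; have := transition_lb (~` A) _ _ x ht h0.
by rewrite !transitionC subrKC => *; apply/andP; split; lra.
Unshelve. all: by end_near. Qed.

End Kernel.

Lemma integral_nat (R : realType) (mu : {measure set nat -> \bar R})
    (f : nat -> \bar R) : (forall x, (0 <= f x)%E) ->
  (\int[mu]_x f x = \sum_(x <oo) f x * mu [set x])%E.
Proof.
move=> f0.
have T : [set: nat] = \bigcup_x [set x].
  by apply/seteqP; split=> // x _; exists x.
rewrite T ge0_integral_bigcup//.
- apply: eq_eseriesr => x _; rewrite -integral_cst//.
  by apply: eq_integral => y; rewrite inE => ->.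
- by move=> i j _ _ [x [-> ->]].
Qed.

Section Law.
Context {R : realType} {d : measure_display} {Om : measurableType d}.
Variables (P : probability Om R) (X : R -> {RV P >-> nat}).
Variable p : R -> R.-pker nat ~> nat.

(** Decompose according to the state at time [t] and apply the Markov property with the sure event
    as the past. *)
Lemma markov_law t h A : markov_process X p -> 0 <= t -> 0 <= h ->
  (distribution P (X (t + h)) A =
   \int[distribution P (X t)]_x p h x A)%E.
Proof.
move=> Xp t0 h0; rewrite integral_nat//.
have -> : distribution P (X (t + h)) A =
    P (\bigcup_x (X t @^-1` [set x] `&` X (t + h) @^-1` A)).
  rewrite -setI_bigcupl; congr (P _).
  by apply/seteqP; split=> [w Aw|w []//]; split=> //; exists (X t w).
have mX s B : measurable (X s @^-1` B).
  by rewrite -[_ @^-1` _]setTI; exact: measurable_funP.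
rewrite measure_bigcup//; last 2 first.
- by move=> x _; apply: measurableI.
- by move=> i j _ _ [w [[/= -> _] [/= -> _]]].
rewrite (eq_eseriesl _ (Q := xpredT)); last by move=> x; rewrite in_setT.
apply: eq_eseriesr => x _; rewrite muleC.
have := Xp t h setT x A t0 h0; rewrite !setTI; apply.
(* The sure event belongs to the filtration as the preimage of [setT] at time 0. *)
by apply: sub_sigma_algebra; exists 0, setT; rewrite preimage_setT.
Qed.

End Law.

(** * Comonotone coupling *)

Lemma measurable_fun_to_nat d (T : measurableType d) (f : T -> nat) :
  (forall n, measurable [set x | (f x <= n)%N]) -> measurable_fun setT f.
Proof.
move=> mf _ B _; rewrite setTI.
have -> : f @^-1` B = \bigcup_(n in B) ([set x | (f x <= n)%N] `\`
    \bigcup_(k in `I_n) [set x | (f x <= k)%N]).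
  apply/seteqP; split=> [x Bfx|x [n Bn /= [fxn nk]]] /=.
    exists (f x) => //; split=> //= -[k /= kf fk].
    by rewrite ltnNge fk in kf.
  suff -> : f x = n by [].
  apply/eqP; rewrite eqn_leq fxn/= leqNgt; apply/negP => ltn.
  by apply: nk; exists (f x) => /=.
apply: bigcup_measurable => n _; apply: measurableD => //.
by apply: bigcup_measurable => k _; exact: mf.
Qed.

Section InitialSegments.
Context {R : realType}.
Implicit Types P Q : probability nat R.

Definition cdf_nat P (n : nat) : R := fine (P [set k | (k <= n)%N]).

Lemma cdf_natE P n : P [set k | (k <= n)%N] = (cdf_nat P n)%:E.
Proof. by rewrite /cdf_nat fineK// fin_num_measure. Qed.

Lemma cdf_nat_ge0 P n : 0 <= cdf_nat P n.
Proof. by rewrite fine_ge0. Qed.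

Lemma cdf_nat_le1 P n : cdf_nat P n <= 1.
Proof. by rewrite -lee_fin -cdf_natE probability_le1. Qed.

Lemma cdf_nat_gt P (u : R) : u < 1 -> exists n, u < cdf_nat P n.
Proof.
move=> u1.
have cvgP : P [set k | (k <= n)%N] @[n --> \oo] --> P setT.
  have -> : [set: nat] = \bigcup_n [set k | (k <= n)%N].
    by apply/seteqP; split=> // k _; exists k => //=.
  apply: nondecreasing_cvg_mu => // m n mn; apply/subsetPset => k /= km.
  exact: leq_trans km mn.
rewrite probability_setT in cvgP.
apply: contrapT => nF; have : (1 <= u%:E)%E; last by rewrite lee_fin leNgt u1.
rewrite -(cvg_lim _ cvgP)//; apply: lime_le; first by apply/cvg_ex; exists 1%E.
apply: nearW => n /=; rewrite cdf_natE lee_fin leNgt; apply/negP => un.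
by apply: nF; exists n.
Qed.

Lemma eq_probability_nat P Q :
  (forall n, P [set k | (k <= n)%N] = Q [set k | (k <= n)%N]) ->
  forall A, P A = Q A.
Proof.
move=> PQ A.
have single n : P [set n] = Q [set n].
  case: n => [|n].
    have -> : [set 0%N] = [set k | (k <= 0)%N].
      by apply/seteqP; split=> k /=; rewrite leqn0 => /eqP.
    exact: PQ.
  have -> : [set n.+1] = [set k | (k <= n.+1)%N] `\` [set k | (k <= n)%N].
    apply/seteqP; split=> k /= => [->|[kn /negP]]; first by split=> //; lia.
    by rewrite -ltnNge => nk; lia.
  have sub : [set k | (k <= n.+1)%N] `&` [set k | (k <= n)%N] = [set k | (k <= n)%N].
    by apply/setIidPr => k /=; lia.
  have fin (P' : probability nat R) m : (P' [set k | (k <= m)%N] < +oo)%E.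
    by rewrite cdf_natE ltry.
  by rewrite !measureD ?fin ?sub //; congr (_ - _)%E; exact: PQ.
have -> : A = \bigcup_(n in A) [set n].
  by apply/seteqP; split=> [k Ak|k [n An ->]//]; exists k.
rewrite !measure_bigcup//; last 2 first.
- by move=> i j _ _ [x [-> ->]].
- by move=> i j _ _ [x [-> ->]].
by apply: eq_eseriesr => n _; exact: single.
Qed.

(** The strict inequality turns events on quantiles into half-open intervals [a, b[. The default 0
    occurs exactly for u >= 1, where the uniform law has no mass. *)
Definition quantile P (u : measurableTypeR R) : nat :=
  if pselect (exists n, u < cdf_nat P n) is left h then ex_minn h else 0%N.

Lemma cdf_nat_nondecreasing P m n : (m <= n)%N -> cdf_nat P m <= cdf_nat P n.
Proof.
move=> mn; rewrite -lee_fin -!cdf_natE le_measure ?inE//.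
by move=> k /= km; exact: leq_trans km mn.
Qed.

Lemma quantile_le P u n : u < 1 -> (quantile P u <= n)%N = (u < cdf_nat P n).
Proof.
move=> u1; rewrite /quantile; case: pselect => [h|/(_ (cdf_nat_gt P u u1))//].
case: ex_minnP => m um mmin; apply/idP/idP => [mn|/mmin//].
exact: lt_le_trans um (cdf_nat_nondecreasing _ _ _ mn).
Qed.

Lemma measurable_quantile P : measurable_fun setT (quantile P).
Proof.
apply: measurable_fun_to_nat => n.
(* By the default value 0, every u >= 1 lies in the sublevel set, so its complement is the bounded
   interval. *)
rewrite (_ : [set x | _] = ~` [set` `[cdf_nat P n, 1[%R]).
  by apply: measurableC; exact: measurable_itv.
apply/seteqP; split=> u /=; rewrite in_itv/=.
  have [u1|u1] := ltP u 1; last by rewrite andbF.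
  by rewrite quantile_le// leNgt => ->.
have [u1|u1 _] := ltP u 1; first by rewrite quantile_le// leNgt andbT => /negP; rewrite negbK.
rewrite /quantile; case: pselect => // h; have [m um] := h.
by have := lt_le_trans um (cdf_nat_le1 P m); rewrite ltNge u1.
Qed.

Definition quantile_pair P Q (u : measurableTypeR R) : nat * nat := (quantile P u, quantile Q u).

Lemma measurable_quantile_pair P Q : measurable_fun setT (quantile_pair P Q).
Proof. by apply: measurable_fun_pair; exact: measurable_quantile. Qed.

HB.instance Definition _ P Q :=
  isMeasurableFun.Build _ _ _ _ (quantile_pair P Q) (measurable_quantile_pair P Q).

Definition comonotone P Q : probability (nat * nat)%type R :=
  distribution (uniform_prob (@ltr01 R)) (quantile_pair P Q).

(** Within [0, 1], [A] and [a, b[ can differ only at the point 1, which is Lebesgue null. The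
    maximum covers an empty interval. *)
Lemma uniform_prob_itv (A : set (measurableTypeR R)) (a b : R) : measurable A ->
  0 <= a -> b <= 1 -> (forall u : R, 0 <= u < 1 -> A u <-> a <= u < b) ->
  uniform_prob (@ltr01 R) A = (Num.max (b - a) 0)%:E.
Proof.
move=> mA a0 b1 Aab.
have -> : uniform_prob (@ltr01 R) A = lebesgue_measure (A `&` `[0, 1]).
  rewrite /uniform_prob integral_uniform_pdf.
  rewrite (eq_integral (fun=> 1%:E)) ?integral_cst ?mul1e//.
    exact: measurableI.
  by move=> x; rewrite inE/= in_itv/= /uniform_pdf => -[_ ->]; rewrite subr0 invr1.
have itvE : lebesgue_measure [set` `[a, b[%R] = (Num.max (b - a) 0)%:E.
  rewrite lebesgue_measure_itv/= lte_fin; have [ab|ab] := ltP a b.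
    by rewrite -EFinB max_l// subr_ge0 ltW.
  by rewrite max_r// subr_le0.
apply/eqP; rewrite eq_le -itvE; apply/andP; split; last first.
  apply: le_measure; rewrite ?inE; [exact: measurable_itv|exact: measurableI|].
  move=> u /=; rewrite !in_itv/= => /andP[au ub].
  have u0 : 0 <= u := le_trans a0 au.
  have u1 : u < 1 := lt_le_trans ub b1.
  by split; [apply/Aab; rewrite ?u0 ?u1 ?au|rewrite u0 ltW].
apply: (@le_trans _ _ (lebesgue_measure ([set` `[a, b[%R] `|` [set 1]))).
  apply: le_measure; rewrite ?inE.
  - exact: measurableI.
  - by apply: measurableU; [exact: measurable_itv|exact: measurable_set1].
  move=> u /= [Au]; rewrite !in_itv/= => /andP[u0].
  rewrite le_eqVlt => /predU1P[->|u1]; [by right|left].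
  by apply/Aab; rewrite ?u0.
apply: (le_trans (measureU2 _ _ _)) => //.
by rewrite [X in (_ + X)%E](lebesgue_measure_set1 (1 : R)) adde0.
Qed.

Lemma comonotone_coupling P Q : coupling P Q (comonotone P Q).
Proof.
have main P' Q' A : uniform_prob (@ltr01 R) (quantile P' @^-1` A) = P' A.
  have mq B : measurable (quantile P' @^-1` B).
    by rewrite -[_ @^-1` _]setTI; exact: measurable_quantile.
  pose mf : {mfun measurableTypeR R >-> nat} := mfun_Sub (mem_set (measurable_quantile P')).
  apply: (eq_probability_nat (distribution (uniform_prob (@ltr01 R)) mf)) => n.
  rewrite [RHS]cdf_natE -[cdf_nat P' n]subr0 -[X in X%:E](@max_l _ _ _ 0).
    apply: uniform_prob_itv; [exact: mq|by []|exact: cdf_nat_le1|].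
    by move=> u /andP[-> u1]; rewrite /= quantile_le.
  by rewrite subr0 cdf_nat_ge0.
by move=> A; split; apply: main.
Qed.

(** In terms of the uniform variable u, this event is F i <= u < G j, where F and G are the
    distribution functions of [P] and [Q]. *)
Lemma comonotone_rectangle P Q i j :
  comonotone P Q [set z | (i < z.1)%N && (z.2 <= j)%N] =
  (Num.max (cdf_nat Q j - cdf_nat P i) 0)%:E.
Proof.
apply: uniform_prob_itv => //.
- rewrite -[_ @^-1` _]setTI; apply: measurable_quantile_pair => //.
  exact: measurable_natnat.
- exact: cdf_nat_ge0.
- exact: cdf_nat_le1.
by move=> u /andP[u0 u1]; rewrite /= quantile_le// ltnNge quantile_le// -leNgt.
Qed.

Lemma comonotone_rectangle_sym P Q i j :
  comonotone P Q [set z | (i < z.2)%N && (z.1 <= j)%N] =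
  (Num.max (cdf_nat P j - cdf_nat Q i) 0)%:E.
Proof.
apply: uniform_prob_itv => //.
- rewrite -[_ @^-1` _]setTI; apply: measurable_quantile_pair => //.
  exact: measurable_natnat.
- exact: cdf_nat_ge0.
- exact: cdf_nat_le1.
by move=> u /andP[u0 u1]; rewrite /= quantile_le// ltnNge quantile_le// -leNgt.
Qed.

End InitialSegments.

(** * Convex costs *)

Section ConvexCost.
Context {R : realType}.
Variable phi : nat -> R.

(** At m = 0 it equals phi 1 - phi 0, because the predecessor of 0 is 0; its nonnegativity for all m
    thus makes [phi] nondecreasing as well as convex. *)
Definition second_difference (m : nat) : R := phi m.+1 - 2 * phi m + phi m.-1.

Hypothesis phi0 : phi 0%N = 0.
Hypothesis phi_convex : forall m, 0 <= second_difference m.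

Definition cost_weight (i j : nat) : R :=
  (j <= i)%N%:R * second_difference (i - j).

Lemma cost_weight_ge0 i j : 0 <= cost_weight i j.
Proof. by rewrite /cost_weight mulr_ge0. Qed.

(** For y < x the active indices are y <= j <= i < x, and summing second differences over j, then i,
    rebuilds phi (x - y). Truncation keeps the sums finite, so that the dual potentials are
    bounded. *)
Definition truncated_cost (N x y : nat) : R :=
  \sum_(i < N) \sum_(j < N) cost_weight i j *
    (((i < x) && (y <= j))%N%:R + ((i < y) && (x <= j))%N%:R).

Lemma truncated_costC N x y : truncated_cost N x y = truncated_cost N y x.
Proof.
by apply: eq_bigr => i _; apply: eq_bigr => j _; rewrite [_%:R + _]addrC.
Qed.

Lemma truncated_cost_nondecreasing x y :
  {homo (fun N => truncated_cost N x y) : m n / (m <= n)%N >-> m <= n}.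
Proof.
have t0 i j : 0 <= cost_weight i j *
    (((i < x) && (y <= j))%N%:R + ((i < y) && (x <= j))%N%:R).
  by rewrite mulr_ge0 ?cost_weight_ge0.
apply: homo_leq => // [a b c|N]; first exact: le_trans.
rewrite /truncated_cost [leRHS]big_ord_recr/= -[leLHS]addr0.
apply: lerD; last by apply: sumr_ge0 => j _; exact: t0.
by apply: ler_sum => i _; rewrite big_ord_recr/= lerDl t0.
Qed.

Lemma sum_delta (N k : nat) (f : nat -> R) : (k < N)%N ->
  \sum_(i < N) (i == k :> nat)%:R * f i = f k.
Proof.
move=> kN; rewrite (bigD1 (Ordinal kN))//= eqxx mul1r big1 ?addr0// => i ik.
by rewrite (negbTE (_ : i != k :> nat)) ?mul0r.
Qed.

(** The sum runs over second differences at 0, ..., m - 1 and telescopes; the boundary value phi 1 -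
    phi 0 at 0 is what makes it start correctly. *)
Lemma sum_second_difference N x m : (x < N)%N -> (m <= x.+1)%N ->
  \sum_(j < N) (x.+1 - m <= j <= x)%N%:R * second_difference (x - j)
  = phi m - phi m.-1.
Proof.
move=> xN; elim: m => [_|m IH mx].
  rewrite subrr big1// => j _; rewrite subn0.
  by rewrite (_ : (_ <= _ <= _)%N = false) ?mul0r//; apply/negbTE; lia.
transitivity (\sum_(j < N) ((j == (x - m)%N :> nat)%:R * second_difference (x - j)
   + (x.+1 - m <= j <= x)%N%:R * second_difference (x - j))).
  apply: eq_bigr => j _; rewrite -mulrDl -natrD; congr (_%:R * _).
  by case: eqP; lia.
rewrite big_split/= IH ?(ltnW mx)//.
rewrite (sum_delta N (x - m) (fun j => second_difference (x - j))); last lia.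
by rewrite subKn// /second_difference; ring.
Qed.

(** Induction on x above y: passing from x to x + 1 activates the row i = x, whose sum is the last
    increment of [phi]. *)
Lemma truncated_cost_eq N x y : (x <= N)%N -> (y <= N)%N ->
  truncated_cost N x y = phi (dist_nat x y).
Proof.
wlog : x y / (y <= x)%N => [wl|].
  have [yx|/ltnW yx] := leqP y x => xN yN; first exact: wl.
  by rewrite truncated_costC dist_natC; exact: wl.
elim: x => [|x IH]; rewrite leq_eqVlt.
  rewrite ltn0 orbF => /eqP -> _ _; rewrite /dist_nat phi0.
  by rewrite /truncated_cost big1// => i _; rewrite big1// => j _; rewrite !mulr0n addr0 mulr0.
case/predU1P => [->|yx] xN yN.
  rewrite /dist_nat subnn phi0 /truncated_cost big1// => i _; rewrite big1// => j _.
  rewrite /cost_weight; have [ji|_] := leqP j i; last by rewrite !mul0r.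
  by rewrite -natrD (_ : (_ + _)%N = 0%N) ?mulr0//; lia.
have dE : dist_nat x.+1 y = (dist_nat x y).+1 by rewrite /dist_nat; lia.
have -> : phi (dist_nat x.+1 y) =
    phi (dist_nat x y) + (phi (dist_nat x.+1 y) - phi (dist_nat x.+1 y).-1).
  by rewrite dE/= addrC subrK.
rewrite -(IH yx (ltnW xN) yN) -(sum_second_difference N x)//; last first.
  by rewrite /dist_nat; lia.
rewrite -(sum_delta N x (fun i => \sum_(j < N) _ * second_difference (i - j)))//.
rewrite /truncated_cost -big_split/=; apply: eq_bigr => i _.
rewrite mulr_sumr -big_split/=; apply: eq_bigr => j _.
have bE : ((j <= i) * (((i < x.+1) && (y <= j)) + ((i < y) && (x.+1 <= j))) =
    (j <= i) * (((i < x) && (y <= j)) + ((i < y) && (x <= j))) +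
    (i == x :> nat) * (x.+1 - dist_nat x.+1 y <= j <= x))%N.
  have -> : (x.+1 - dist_nat x.+1 y = y)%N by rewrite /dist_nat; lia.
  lia.
have {}bE := congr1 (fun k : nat => k%:R : R) bE.
rewrite natrD !natrM !natrD in bE.
rewrite /cost_weight [LHS]mulrAC bE mulrDl [in RHS]mulrAC; congr (_ + _).
case: eqP => [->|_]; last by rewrite !mul0r.
by rewrite !mul1r.
Qed.

End ConvexCost.

(** * Duality and transport *)

Section Duality.
Context {R : realType}.
Variable phi : nat -> R.
Hypothesis phi0 : phi 0%N = 0.
Hypothesis phi_convex : forall m, 0 <= second_difference phi m.

Lemma truncated_cost_le N x y : truncated_cost phi N x y <= phi (dist_nat x y).
Proof.
rewrite -(truncated_cost_eq phi phi0 (N + x + y)); [|lia..].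
apply: truncated_cost_nondecreasing => //; lia.
Qed.

Lemma truncated_cost_ge0 N x y : 0 <= truncated_cost phi N x y.
Proof.
apply: sumr_ge0 => i _; apply: sumr_ge0 => j _.
by rewrite mulr_ge0 ?cost_weight_ge0.
Qed.

Lemma integral_truncated_cost N (P Q : probability nat R) :
  (\int[comonotone P Q]_z (truncated_cost phi N z.1 z.2)%:E)%E =
  (\sum_(i < N) \sum_(j < N) cost_weight phi i j *
    (Num.max (cdf_nat Q j - cdf_nat P i) 0 +
     Num.max (cdf_nat P j - cdf_nat Q i) 0))%:E.
Proof.
pose pi := comonotone P Q.
pose A (i j : nat) := [set z : nat * nat | (i < z.1)%N && (z.2 <= j)%N].
pose B (i j : nat) := [set z : nat * nat | (i < z.2)%N && (z.1 <= j)%N].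
have AE i j z : \1_(A i j) z = ((i < z.1) && (z.2 <= j))%N%:R :> R.
  by rewrite indicE; congr ((nat_of_bool _)%:R); apply/idP/idP; rewrite inE.
have BE i j z : \1_(B i j) z = ((i < z.2) && (z.1 <= j))%N%:R :> R.
  by rewrite indicE; congr ((nat_of_bool _)%:R); apply/idP/idP; rewrite inE.
have w0 i j := cost_weight_ge0 phi phi_convex i j.
transitivity (\sum_(i < N) \sum_(j < N)
    \int[pi]_z ((cost_weight phi i j * (\1_(A i j) z + \1_(B i j) z))%:E))%E.
  transitivity (\sum_(i < N) \int[pi]_z
      (\sum_(j < N) (cost_weight phi i j * (\1_(A i j) z + \1_(B i j) z))%:E))%E.
    rewrite -ge0_integral_sum//; last 2 first.
    - by move=> i; exact: measurable_natnat_fun.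
    - by move=> i z _; apply: sume_ge0 => j _; rewrite lee_fin mulr_ge0 ?w0// addr_ge0.
    apply: eq_integral => z _; rewrite /truncated_cost -sumEFin.
    apply: eq_bigr => i _; rewrite -sumEFin; apply: eq_bigr => j _.
    by rewrite AE BE.
  apply: eq_bigr => i _; rewrite ge0_integral_sum//.
  - by move=> j; exact: measurable_natnat_fun.
  - by move=> j z _; rewrite lee_fin mulr_ge0 ?w0// addr_ge0.
rewrite -sumEFin; apply: eq_bigr => i _; rewrite -sumEFin; apply: eq_bigr => j _.
under eq_integral do rewrite EFinM.
rewrite ge0_integralZl_EFin//; last exact: measurable_natnat_fun.
rewrite [RHS]EFinM; apply: (congr1 (mule _)).
under eq_integral do rewrite EFinD.
rewrite ge0_integralD//; try exact: measurable_natnat_fun.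
rewrite !integral_indic ?setIT; try exact: measurable_natnat.
by rewrite EFinD -comonotone_rectangle -comonotone_rectangle_sym.
Qed.

(* The sign of G j - F i selects a dual pair of Kantorovich potentials. *)
Lemma truncated_cost_dual N (P Q : probability nat R) : exists a b : nat -> R,
  (forall x y, \sum_(i < N) (a i * (x <= i)%N%:R + b i * (y <= i)%N%:R)
    <= phi (dist_nat x y)) /\
  (\int[comonotone P Q]_z (truncated_cost phi N z.1 z.2)%:E)%E =
  (\sum_(i < N) (a i * cdf_nat P i + b i * cdf_nat Q i))%:E.
Proof.
pose c (i j : nat) : R := cost_weight phi i j * (cdf_nat P i < cdf_nat Q j)%R%:R.
pose d (i j : nat) : R := cost_weight phi i j * (cdf_nat Q i < cdf_nat P j)%R%:R.
pose a (i : nat) := \sum_(j < N) (d j i - c i j).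
pose b (i : nat) := \sum_(j < N) (c j i - d i j).
have lin (f g : nat -> R) : \sum_(i < N) (a i * f i + b i * g i) =
    \sum_(i < N) \sum_(j < N) (c i j * (g j - f i) + d i j * (f j - g i)).
  transitivity (\sum_(i < N) \sum_(j < N) (d j i * f i + c j i * g i) -
      \sum_(i < N) \sum_(j < N) (c i j * f i + d i j * g i)).
    rewrite -sumrB; apply: eq_bigr => i _; rewrite -sumrB /a /b !mulr_suml.
    by rewrite -big_split/=; apply: eq_bigr => j _; ring.
  rewrite exchange_big/= -sumrB; apply: eq_bigr => i _; rewrite -sumrB.
  by apply: eq_bigr => j _; ring.
exists a, b; split=> [x y|]; last first.
  rewrite integral_truncated_cost lin; congr EFin.
  apply: eq_bigr => i _; apply: eq_bigr => j _; rewrite /c /d mulrDr.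
  by congr (_ + _); rewrite -mulrA; congr (_ * _);
     (case: ltP => h; [rewrite mul1r max_l// subr_ge0 ltW|rewrite mul0r max_r// subr_le0]).
(* Whatever sign was selected, s (1_{y <= j} - 1_{x <= i}) <= 1_{i < x, y <= j} for s in {0, 1}. *)
apply: le_trans (truncated_cost_le N x y).
rewrite (lin (fun i => (x <= i)%N%:R) (fun i => (y <= i)%N%:R)).
apply: ler_sum => i _; apply: ler_sum => j _; rewrite /c /d.
have := cost_weight_ge0 phi phi_convex i j; move: (cost_weight phi i j) => w w0.
rewrite [leRHS]mulrDr -!mulrA; apply: lerD; rewrite ler_wpM2l//.
- by case: (cdf_nat P i < _)%R; case: (leqP x i) => _; case: (leqP y j) => _ /=; lra.
- by case: (cdf_nat Q i < _)%R; case: (leqP y i) => _; case: (leqP x j) => _ /=; lra.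
Qed.

Lemma integral_comonotone_le (P Q : probability nat R) (M : \bar R) :
  (forall N, \int[comonotone P Q]_z (truncated_cost phi N z.1 z.2)%:E <= M)%E ->
  (\int[comonotone P Q]_z (phi (dist_nat z.1 z.2))%:E <= M)%E.
Proof.
move=> TM; set pi := comonotone P Q.
have nd (z : nat * nat) :
    {homo (fun N => (truncated_cost phi N z.1 z.2)%:E) : m n / (m <= n)%N >-> (m <= n)%E}.
  by move=> m n mn; rewrite lee_fin; exact: truncated_cost_nondecreasing.
have -> : (\int[pi]_z (phi (dist_nat z.1 z.2))%:E =
    limn (fun N => \int[pi]_z (truncated_cost phi N z.1 z.2)%:E))%E.
  rewrite -monotone_convergence//.
  - apply: eq_integral => z _; apply/esym/cvg_lim => //.
    apply: cvg_near_cst; exists (z.1 + z.2)%N => // N /= zN.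
    by rewrite truncated_cost_eq//; lia.
  - by move=> N; exact: measurable_natnat_fun.
  - by move=> N z _; rewrite lee_fin truncated_cost_ge0.
apply: lime_le; last by apply: nearW => N; exact: TM.
apply: ereal_nondecreasing_is_cvgn => m n mn; apply: ge0_le_integral => //.
- by move=> z _; rewrite lee_fin truncated_cost_ge0.
- exact: measurable_natnat_fun.
- exact: measurable_natnat_fun.
- by move=> z _; exact: nd.
Qed.

End Duality.

(** * Marginals of a coupling and weak duality *)

Lemma integrable_bounded d (T : measurableType d) (R : realType)
    (P : probability T R) (f : T -> R) (B : R) :
  measurable_fun setT f -> (forall x, `|f x| <= B) ->
  P.-integrable setT (EFin \o f).
Proof.
move=> mf fB; apply: measurable_bounded_integrable => //.
- by rewrite (le_lt_trans (probability_le1 _ _))// ltry.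
- by exists B; split; [exact: num_real|move=> M BM x _ /=; rewrite (le_trans (fB x))// ltW].
Qed.

Section Marginals.
Context {R : realType}.
Variables (P Q : probability nat R) (pi : probability (nat * nat)%type R).
Hypothesis cpl : coupling P Q pi.

Let PE (f : nat -> \bar R) :
  (\int[P]_x f x = \int[pushforward pi (@fst nat nat)]_x f x)%E.
Proof. by apply/esym/eq_measure_integral => A _ _; exact: (cpl A).1. Qed.

Let QE (f : nat -> \bar R) :
  (\int[Q]_x f x = \int[pushforward pi (@snd nat nat)]_x f x)%E.
Proof. by apply/esym/eq_measure_integral => A _ _; exact: (cpl A).2. Qed.

Lemma ge0_integral_marginals (f : nat -> \bar R) : (forall x, (0 <= f x)%E) ->
  (\int[pi]_z f z.1 = \int[P]_x f x)%E /\ (\int[pi]_z f z.2 = \int[Q]_x f x)%E.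
Proof.
move=> f0; rewrite PE QE; split; rewrite ge0_integral_pushforward//;
  exact: measurable_nat_fun.
Qed.

Lemma integral_marginals (f : nat -> R) (B : R) : (forall x, `|f x| <= B) ->
  (\int[pi]_z (f z.1)%:E = \int[P]_x (f x)%:E)%E /\
  (\int[pi]_z (f z.2)%:E = \int[Q]_x (f x)%:E)%E.
Proof.
move=> fB; rewrite PE QE; split; rewrite integral_pushforward//.
- apply: (integrable_bounded _ _ _ pi (fun z => f z.1) B) => //.
  exact: measurable_natnat_fun.
- apply: (integrable_bounded _ _ _ pi (fun z => f z.2) B) => //.
  exact: measurable_natnat_fun.
Qed.

(** The cost may have infinite integral; the comparison passes through the positive part of u + v,
    which lies below [f] because [f] is nonnegative. *)
Lemma weak_duality (u v : nat -> R) (B1 B2 : R) (f : nat * nat -> R) :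
  (forall x, `|u x| <= B1) -> (forall y, `|v y| <= B2) -> (forall z, 0 <= f z) ->
  (forall z, u z.1 + v z.2 <= f z) ->
  (\int[P]_x (u x)%:E + \int[Q]_y (v y)%:E <= \int[pi]_z (f z)%:E)%E.
Proof.
move=> uB vB f0 uvf.
rewrite -(integral_marginals u B1 uB).1 -(integral_marginals v B2 vB).2.
rewrite -integralD//; last 2 first.
- apply: (integrable_bounded _ _ _ _ (fun z => u z.1) B1) => [|z]; last exact: uB.
  exact: measurable_natnat_fun.
- apply: (integrable_bounded _ _ _ _ (fun z => v z.2) B2) => [|z]; last exact: vB.
  exact: measurable_natnat_fun.
pose w (z : nat * nat) := ((u z.1)%:E + (v z.2)%:E)%E.
apply: (@le_trans _ _ (\int[pi]_z w^\+ z)%E).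
  rewrite integralE -[leRHS]sube0; apply: leeB => //.
  exact: integral_ge0.
apply: ge0_le_integral => //.
- exact: measurable_natnat_fun.
- exact: measurable_natnat_fun.
- by move=> z _; rewrite funeposE /w -EFinD ge_max !lee_fin f0 andbT.
Qed.

End Marginals.

Lemma lincomb_bounded (R : realType) N (a : nat -> R) (g : nat -> nat -> R) x :
  (forall i x, `|g i x| <= 1) ->
  `|\sum_(i < N) a i * g i x| <= \sum_(i < N) `|a i|.
Proof.
move=> g1; apply: le_trans (ler_norm_sum _ _ _) _.
by apply: ler_sum => i _; rewrite normrM ler_piMr.
Qed.

Lemma integral_lincomb (R : realType) (P : probability nat R) N (a : nat -> R)
    (g : nat -> nat -> R) (c : nat -> R) : (forall i x, `|g i x| <= 1) ->
  (forall i, \int[P]_x (g i x)%:E = (c i)%:E)%E ->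
  (\int[P]_x (\sum_(i < N) a i * g i x)%:E = (\sum_(i < N) a i * c i)%:E)%E.
Proof.
move=> g1 gc.
have ig i : P.-integrable setT (fun x => (g i x)%:E).
  by apply: (integrable_bounded _ _ _ _ (g i) 1) => //; exact: measurable_nat_fun.
under eq_integral do rewrite -sumEFin.
rewrite integral_sum//; last first.
  by move=> i; exact: (integrableZl measurableT (a i) (ig _)).
rewrite -sumEFin; apply: eq_bigr => i _.
under eq_integral do rewrite EFinM.
by rewrite integralZl// EFinM gc.
Qed.

Lemma integral_initial_segment (R : realType) (P : probability nat R) i :
  (\int[P]_x (x <= i)%N%:R%:E = (cdf_nat P i)%:E)%E.
Proof.
rewrite -cdf_natE -[X in P X]setIT -integral_indic//.
apply: eq_integral => x _; rewrite indicE; congr ((nat_of_bool _)%:R%:E).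
by apply/idP/idP; rewrite inE.
Qed.

(** For each N the dual pair attains the truncated comonotone cost and is feasible for the full
    cost, so weak duality applies to any competitor [pi]; monotone convergence in N concludes. *)
Lemma comonotone_optimal (R : realType) (phi : nat -> R) (P Q : probability nat R)
    (pi : probability (nat * nat)%type R) :
  phi 0%N = 0 -> (forall m, 0 <= second_difference phi m) ->
  (forall k, 0 <= phi k) -> coupling P Q pi ->
  (\int[comonotone P Q]_z (phi (dist_nat z.1 z.2))%:E <=
   \int[pi]_z (phi (dist_nat z.1 z.2))%:E)%E.
Proof.
move=> phi0 cvx phi_ge0 cpl; apply: integral_comonotone_le => // N.
have [a [b [abphi ->]]] := truncated_cost_dual phi phi0 cvx N P Q.
have g1 i x : `|(x <= i)%N%:R : R| <= 1 by rewrite normr_nat; case: (x <= i)%N.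
rewrite big_split EFinD.
rewrite -!(integral_lincomb _ _ _ _ _ _ g1 (integral_initial_segment _ _)).
apply: (weak_duality _ _ _ cpl _ _ _ _ (fun z => phi (dist_nat z.1 z.2))
  (fun x => lincomb_bounded _ N a _ x g1) (fun x => lincomb_bounded _ N b _ x g1)) => // z.
by rewrite -big_split; exact: abphi.
Qed.

Section Transport.
Context {R : realType}.
Variables (eta nu : nat -> R) (C : R).
Hypotheses (eta0 : forall x, 0 <= eta x) (nu0 : forall x, 0 <= nu x).
Hypotheses (C0 : 0 < C) (etaC : forall x, eta x <= C * (1 + x%:R)).

Lemma bd_generator_sum (I : Type) (r : seq I) (a : I -> R) (u : I -> nat -> R) x :
  bd_generator eta nu (fun x => \sum_(i <- r) a i * u i x) x =
  \sum_(i <- r) a i * bd_generator eta nu (u i) x.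
Proof.
rewrite /bd_generator -!sumrB !mulr_sumr -big_split/=.
by apply: eq_bigr => i _; ring.
Qed.

Section Evolution.
Variable p : R -> R.-pker nat ~> nat.
Hypotheses (pS : markov_semigroup p) (pG : has_generator p (bd_generator eta nu)).
Variables (N : nat) (a : nat -> R).

(** The potential x -> sum_i a_i 1_{x <= i} evolved by the semigroup. Bounds and derivatives are
    obtained term by term. *)
Definition evolution (t : R) (x : nat) : R :=
  \sum_(i < N) a i * transition p [set k | (k <= i)%N] t x.

Lemma evolution0 x : evolution 0 x = \sum_(i < N) a i * (x <= i)%N%:R.
Proof.
apply: eq_bigr => i _; rewrite transition0//; congr (_ * _%:R).
by congr nat_of_bool; apply/idP/idP; rewrite inE.
Qed.

Lemma evolution_bounded : exists B : R, forall t x, `|evolution t x| <= B.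
Proof.
exists (\sum_(i < N) `|a i|) => t x; apply: (lincomb_bounded _ N a
  (fun i => transition p [set k | (k <= i)%N] t)) => i y.
by rewrite ger0_norm ?transition_ge0 ?transition_le1.
Qed.

Lemma evolution_right_derivative t x : 0 <= t ->
  right_derivative (fun s => evolution s x) t
    (bd_generator eta nu (evolution t) x).
Proof.
move=> t0; rewrite (bd_generator_sum _ _ (fun i : 'I_N => a i)
  (fun i : 'I_N => transition p [set k | (k <= i)%N] t)).
apply: right_derivative_sum => i; apply: right_derivativeM.
exact: transition_right_derivative.
Qed.

Lemma evolution_left_continuous t x : 0 < t ->
  left_continuous_at (fun s => evolution s x) t.
Proof.
move=> t0; apply: left_continuous_sum => i; apply: left_continuousM.
exact: transition_left_continuous pS pG _ _ _ t0.
Qed.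

Lemma integral_evolution (mu nu' : probability nat R) h :
  (forall A, nu' A = \int[mu]_x p h x A)%E ->
  (\int[mu]_x (evolution h x)%:E =
   (\sum_(i < N) a i * cdf_nat nu' i)%:E)%E.
Proof.
move=> law; apply: (integral_lincomb _ _ N a
  (fun i => transition p [set k | (k <= i)%N] h)) => [i x|i].
  by rewrite ger0_norm ?transition_ge0 ?transition_le1.
by rewrite -cdf_natE law; apply: eq_integral => x _; rewrite -transitionE.
Qed.

End Evolution.

Variables p p' : R -> R.-pker nat ~> nat.
Hypotheses (pS : markov_semigroup p) (pG : has_generator p (bd_generator eta nu)).
Hypotheses (pS' : markov_semigroup p') (pG' : has_generator p' (bd_generator eta nu)).
Variables mu mu' : R -> probability nat R.
Hypothesis mu_law : forall (t h : R) A, 0 <= t -> 0 <= h ->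
  (mu (t + h) A = \int[mu t]_x p h x A)%E.
Hypothesis mu_law' : forall (t h : R) A, 0 <= t -> 0 <= h ->
  (mu' (t + h) A = \int[mu' t]_x p' h x A)%E.

Lemma evolution_dominated (phi : nat -> R) (S dS : R -> nat -> R) N
    (a b : nat -> R) :
  (forall x y, \sum_(i < N) (a i * (x <= i)%N%:R + b i * (y <= i)%N%:R)
    <= phi (dist_nat x y)) ->
  (forall (s : R) k, is_derive s 1 (S^~ k) (dS s k)) ->
  (forall (s : R) k, 0 <= s -> 0 <= S s k) -> (forall k, phi k <= S 0 k) ->
  (forall (s : R) x y, 0 <= s ->
    coupled_generator eta nu (fun x y => S s (dist_nat x y)) x y
      <= dS s (dist_nat x y)) ->
  forall (h : R) x y, 0 <= h ->
    evolution p N a h x + evolution p' N b h y <= S h (dist_nat x y).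
Proof.
move=> abphi Sd S0 phiS Sgen h x y h0; rewrite -subr_le0.
pose Z (s : R) x y := evolution p N a s x + evolution p' N b s y - S s (dist_nat x y).
pose D (s : R) x y := bd_generator eta nu (evolution p N a s) x +
  bd_generator eta nu (evolution p' N b s) y - dS s (dist_nat x y).
apply: (coupled_maximum_principle eta nu eta0 nu0 C Z D C0 etaC _ _ _ _ _ h x y h0).
- have [B1 H1] := evolution_bounded p N a; have [B2 H2] := evolution_bounded p' N b.
  exists (B1 + B2) => s u v s0; rewrite /Z lerBlDr -[leLHS]addr0 lerD ?S0//.
  by rewrite lerD// (le_trans (ler_norm _)).
- move=> s u v s0; apply: right_derivativeD.
    by apply: right_derivativeD; exact: evolution_right_derivative.
  exact: (is_derive_right _ _ _ (is_deriveN (Sd _ _))).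
- move=> s u v s0; apply: left_continuousD.
    by apply: left_continuousD; apply: evolution_left_continuous.
  exact: (is_derive_left _ _ _ (is_deriveN (Sd _ _))).
- move=> s u v s0; rewrite /Z coupled_generatorB coupled_generator_marginals.
  by rewrite /D lerD2l lerN2 Sgen.
- move=> u v; rewrite /Z !evolution0// -big_split/= subr_le0.
  exact: le_trans (abphi u v) (phiS _).
Qed.

(** Potentials that are dual for [phi] at time [t + h], pulled back to time [t] by the two
    semigroups, are feasible for the cost [S h]; weak duality then holds against any coupling at
    time [t]. *)
Theorem comonotone_transport (phi : nat -> R) (S dS : R -> nat -> R) (t h : R)
    (pi : probability (nat * nat)%type R) :
  phi 0%N = 0 -> (forall m, 0 <= second_difference phi m) ->
  (forall (s : R) k, is_derive s 1 (S^~ k) (dS s k)) ->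
  (forall (s : R) k, 0 <= s -> 0 <= S s k) -> (forall k, phi k <= S 0 k) ->
  (forall (s : R) x y, 0 <= s ->
    coupled_generator eta nu (fun x y => S s (dist_nat x y)) x y
      <= dS s (dist_nat x y)) ->
  0 <= t -> 0 <= h -> coupling (mu t) (mu' t) pi ->
  (\int[comonotone (mu (t + h)) (mu' (t + h))]_z (phi (dist_nat z.1 z.2))%:E
   <= \int[pi]_z (S h (dist_nat z.1 z.2))%:E)%E.
Proof.
move=> phi0 cvx Sd S0 phiS Sgen t0 h0 cpl.
apply: integral_comonotone_le => // N.
have [a [b [abphi ->]]] := truncated_cost_dual phi phi0 cvx N (mu (t + h)) (mu' (t + h)).
have dom := evolution_dominated phi S dS N a b abphi Sd S0 phiS Sgen h.
have [B1 H1] := evolution_bounded p N a; have [B2 H2] := evolution_bounded p' N b.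
rewrite big_split EFinD.
rewrite -(integral_evolution p N a (mu t) _ h (fun A => mu_law t h A t0 h0)).
rewrite -(integral_evolution p' N b (mu' t) _ h (fun A => mu_law' t h A t0 h0)).
apply: (weak_duality _ _ _ cpl _ _ _ _ (fun z => S h (dist_nat z.1 z.2))
  (H1 h) (H2 h)) => z; first exact: S0.
exact: dom.
Qed.

End Transport.

(** * Wasserstein distances as comonotone costs *)

Section Wasserstein.
Context {R : realType}.
Implicit Types P Q : probability nat R.

Definition comonotone_cost (phi : nat -> R) P Q : \bar R :=
  (\int[comonotone P Q]_z (phi (dist_nat z.1 z.2))%:E)%E.

Lemma dist_natE x y : `|x%:R - y%:R| = (dist_nat x y)%:R :> R.
Proof.
have [xy|/ltnW yx] := leqP x y.
  rewrite distrC -natrB// ger0_norm//; congr _%:R; rewrite /dist_nat; lia.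
by rewrite -natrB// ger0_norm//; congr _%:R; rewrite /dist_nat; lia.
Qed.

Lemma power_convex (q : R) m : 1 <= q ->
  0 <= second_difference (fun k => k%:R `^ q) m.
Proof.
move=> q1; rewrite /second_difference.
have [->/=|m0] := posnP m.
  rewrite powR0 ?mulr0 ?subr0 ?addr0 ?powR_ge0//.
  by rewrite gt_eqF// (lt_le_trans _ q1).
by have := powR_midconvex q m q1 m0; lra.
Qed.

Lemma natr_convex m : 0 <= second_difference (fun k => k%:R : R) m.
Proof.
rewrite /second_difference; case: m => [|m] /=; first by rewrite mulr0 subr0 addr0.
by rewrite -!natr1; lra.
Qed.

Lemma wasserstein_power (q : R) P Q : 1 <= q ->
  (wasserstein q P Q `^ q = comonotone_cost (fun k => k%:R `^ q)%R P Q)%E.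
Proof.
move=> q1; have q0 : 0 < q by exact: lt_le_trans q1.
have dE (pi : probability (nat * nat)%type R) : (\int[pi]_z (`|z.1%:R - z.2%:R| `^ q)%:E =
    \int[pi]_z ((dist_nat z.1 z.2)%:R `^ q)%:E :> \bar R)%E.
  by apply: eq_integral => z _; rewrite dist_natE.
rewrite /wasserstein -poweRrM mulVf ?gt_eqF// poweRe1; last first.
  apply: le_ereal_inf_tmp => _ [pi _ <-]; apply: integral_ge0 => z _.
  by rewrite lee_fin powR_ge0.
apply/eqP; rewrite eq_le; apply/andP; split.
  apply: ereal_inf_lbound; exists (comonotone P Q); last exact: dE.
  exact: comonotone_coupling.
apply: le_ereal_inf_tmp => _ [pi cpl <-]; rewrite dE.
apply: (comonotone_optimal _ (fun k => k%:R `^ q)) => //.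
- by rewrite powR0// gt_eqF.
- by move=> m; exact: power_convex.
Qed.

Lemma wasserstein1 P Q :
  wasserstein 1 P Q = comonotone_cost (fun k => k%:R) P Q.
Proof.
transitivity (wasserstein 1 P Q `^ 1)%E.
  by rewrite poweRe1// poweR_ge0.
by rewrite wasserstein_power//; apply: eq_integral => z _; rewrite powRr1.
Qed.

Lemma comonotone_cost_lin (a b : R) (f g : nat -> R) P Q : 0 <= a -> 0 <= b ->
  (forall k, 0 <= f k) -> (forall k, 0 <= g k) ->
  comonotone_cost (fun k => a * f k + b * g k) P Q =
  (a%:E * comonotone_cost f P Q + b%:E * comonotone_cost g P Q)%E.
Proof.
move=> a0 b0 f0 g0; rewrite /comonotone_cost.
rewrite -!ge0_integralZl_EFin//; try first [exact: measurable_natnat_fun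
  |by move=> z _; rewrite lee_fin].
rewrite -ge0_integralD//; try first [exact: measurable_natnat_fun
  |by move=> z _; rewrite -EFinM lee_fin mulr_ge0].
Qed.

Lemma comonotone_cost_scale (a : R) (f : nat -> R) P Q : 0 <= a ->
  (forall k, 0 <= f k) ->
  comonotone_cost (fun k => a * f k) P Q = (a%:E * comonotone_cost f P Q)%E.
Proof.
move=> a0 f0; rewrite /comonotone_cost -ge0_integralZl_EFin//;
  first [exact: measurable_natnat_fun|by move=> z _; rewrite lee_fin].
Qed.

Lemma comonotone_cost_ge0 (f : nat -> R) P Q : (forall k, 0 <= f k) ->
  (0 <= comonotone_cost f P Q)%E.
Proof. by move=> f0; apply: integral_ge0 => z _; rewrite lee_fin. Qed.

(** The distance is at most the larger coordinate, so the cost is bounded by A (1 + x^rho) + A (1 +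
    y^rho), whose integral depends on the marginals alone. *)
Lemma comonotone_cost_lty (f : nat -> R) (A rho : R) P Q : 0 <= A -> 0 < rho ->
  (forall k, 0 <= f k) -> (forall k, f k <= A * (1 + k%:R `^ rho)) ->
  (\int[P]_x (x%:R `^ rho)%:E < +oo)%E ->
  (\int[Q]_x (x%:R `^ rho)%:E < +oo)%E ->
  (comonotone_cost f P Q < +oo)%E.
Proof.
move=> A0 rho0 f0 fA Pf Qf.
have g0 (x : nat) : (0 <= (1 + x%:R `^ rho)%:E :> \bar R)%E.
  by rewrite lee_fin addr_ge0// powR_ge0.
have mom (P' : probability nat R) : (\int[P']_x (x%:R `^ rho)%:E < +oo)%E ->
    (\int[P']_x (1 + x%:R `^ rho)%:E < +oo)%E.
  move=> P'f; under eq_integral do rewrite EFinD.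
  rewrite ge0_integralD//; try first [exact: measurable_nat_fun
    |by move=> x _; rewrite lee_fin powR_ge0].
  rewrite integral_cst//= mul1e lte_add_pinfty//.
  by rewrite (le_lt_trans (probability_le1 _ _))// ltry.
have [H1 H2] := ge0_integral_marginals _ _ _ (comonotone_coupling P Q) _ g0.
apply: (@le_lt_trans _ _ (\int[comonotone P Q]_z
   (A%:E * ((1 + z.1%:R `^ rho)%:E + (1 + z.2%:R `^ rho)%:E)))%E).
  apply: ge0_le_integral => //.
  - by move=> z _; rewrite lee_fin.
  - exact: measurable_natnat_fun.
  - exact: measurable_natnat_fun.
  move=> z _; rewrite -EFinD -EFinM lee_fin (le_trans (fA _))// ler_wpM2l//.
  have dle (x y : nat) : (x <= y)%N -> (x%:R : R) `^ rho <= y%:R `^ rho.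
    by move=> xy; rewrite ge0_ler_powR ?nnegrE ?(ltW rho0)// ler_nat.
  have p1 := powR_ge0 (z.1%:R : R) rho; have p2 := powR_ge0 (z.2%:R : R) rho.
  have [xy|/ltnW yx] := leqP z.1 z.2.
    have : (dist_nat z.1 z.2 <= z.2)%N by rewrite /dist_nat; lia.
    by move/dle; lra.
  have : (dist_nat z.1 z.2 <= z.1)%N by rewrite /dist_nat; lia.
  by move/dle; lra.
rewrite ge0_integralZl_EFin//; last 2 first.
- by move=> z _; rewrite adde_ge0.
- exact: measurable_natnat_fun.
rewrite ge0_integralD//; try exact: measurable_natnat_fun.
by rewrite H1 H2 lte_mul_pinfty// lte_add_pinfty// mom.
Qed.

End Wasserstein.

(** * From one-step estimates to an integral inequality *)

Section MonotoneGronwall.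
Context {R : realType}.
Variables (a b : R -> R) (K N : R).
Hypotheses (K0 : 0 <= K) (N0 : 0 <= N).
Hypothesis b0 : forall r : R, 0 <= r -> 0 <= b r.
Hypothesis bN : forall r h : R, 0 <= r -> 0 <= h -> b (r + h) <= expR (N * h) * b r.
Hypothesis ab : forall r h : R, 0 <= r -> 0 <= h ->
  a (r + h) <= a r + K * h * expR (N * h) * b r.

(** By [bN] the function exp (-N r) b(r) is nonincreasing, so b is a product of two monotone
    functions; clamping at 0 extends this to the whole line. *)
Let mb (D : set R) : measurable D -> D `<=` `[0, +oo[ -> measurable_fun D b.
Proof.
move=> mD D0.
pose beta r := expR (- N * Num.max r 0) * b (Num.max r 0).
have beta_ni : nonincreasing_fun beta.
  move=> r s rs; rewrite /beta.
  have : Num.max r 0 <= Num.max s 0 by rewrite ge_max !le_max rs lexx !orbT.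
  have : 0 <= Num.max r 0 by rewrite le_max lexx orbT.
  move: (Num.max r 0) (Num.max s 0) => x y x0 xy.
  have xy0 : 0 <= y - x by rewrite subr_ge0.
  have := bN x (y - x) x0 xy0; rewrite subrKC => h.
  rewrite (le_trans (ler_wpM2l (expR_ge0 _) h))// mulrA -expRD.
  by rewrite (_ : - N * y + N * (y - x) = - N * x)//; ring.
have bE : {in D, (fun r => expR (N * r) * beta r) =1 b}.
  move=> r; rewrite inE => /D0/=; rewrite in_itv/= andbT => r0.
  by rewrite /beta max_l// mulrA -expRD mulNr subrr expR0 mul1r.
apply: (eq_measurable_fun _ bE); apply: measurable_funM.
  apply: nondecreasing_measurable => // r s rs.
  by rewrite ler_expR ler_wpM2l.
exact: nonincreasing_measurable.
Qed.

Let J (t : R) : \bar R := (\int[lebesgue_measure]_(r in `[0%R, t]) (b r)%:E)%E.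

Let J0 t : (0 <= J t)%E.
Proof.
by apply: integral_ge0 => r; rewrite /= in_itv/= => /andP[r0 _]; rewrite lee_fin b0.
Qed.

(** On ]x, x + h] the growth bound, read backwards, gives b r >= exp (-N h) b (x + h). *)
Let J_step x h : 0 <= x -> 0 <= h ->
  (J x + (h * expR (- N * h) * b (x + h))%:E <= J (x + h))%E.
Proof.
move=> x0 h0; rewrite /J.
have -> : `[0, x + h]%classic = `[0, x]%classic `|` `]x, x + h]%classic :> set R.
  rewrite (@itv_bndbnd_setU _ _ (BLeft 0) (BRight x) (BRight (x + h)))//.
  by rewrite bnd_simp lerDl.
have sub : `]x, x + h] `<=` `[0, +oo[%classic.
  by move=> r /=; rewrite !in_itv/= andbT => /andP[/ltW/(le_trans x0)].
have sub' : `[0, x] `<=` `[0, +oo[%classic.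
  by move=> r /=; rewrite !in_itv/= andbT => /andP[].
rewrite ge0_integral_setU//=.
- apply: leeD; first exact: lexx.
  have -> : ((h * expR (- N * h) * b (x + h))%:E = \int[lebesgue_measure]_(r in
      `]x, (x + h)%R]) (expR (- N * h) * b (x + h))%:E)%E.
    rewrite integral_cst//= lebesgue_measure_itv/= lte_fin.
    have [_|hx] := ltP x (x + h).
      by rewrite -EFinB -EFinM; congr EFin; ring.
    by rewrite mule0 (_ : h = 0) ?mul0r//; lra.
  apply: ge0_le_integral => //.
  - by move=> r _; rewrite lee_fin mulr_ge0 ?expR_ge0// b0// addr_ge0.
  - by apply/measurable_EFinP; exact: mb.
  move=> r /=; rewrite in_itv/= => /andP[xr rxh]; rewrite lee_fin.
  have r0 : 0 <= r by rewrite (le_trans x0)// ltW.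
  have rh : 0 <= x + h - r by rewrite subr_ge0.
  have := bN r (x + h - r) r0 rh; rewrite subrKC => H.
  apply: (le_trans (ler_wpM2l (expR_ge0 _) H)); rewrite mulrA -expRD.
  rewrite -[leRHS]mul1r ler_wpM2r ?b0// -expR0 ler_expR.
  by rewrite mulNr addrC subr_le0 ler_wpM2l//; lra.
- apply/measurable_EFinP; apply: mb; first exact: measurableU.
  by move=> r [/sub'|/sub].
- by move=> r [/sub'|/sub] /=; rewrite in_itv/= andbT lee_fin => /b0.
- apply/disj_setPS => r [] /=; rewrite !in_itv/= => /andP[_ rx] /andP[xr _].
  by have := lt_le_trans xr rx; rewrite ltxx.
Qed.

Let J_fin t : 0 <= t -> J t \is a fin_num.
Proof.
move=> t0; rewrite ge0_fin_numE//.
apply: (@le_lt_trans _ _ (\int[lebesgue_measure]_(r in `[0%R, t]) (expR (N * t) * b 0)%:E)%E).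
  apply: ge0_le_integral => //.
  - by move=> r /=; rewrite in_itv/= => /andP[r0 _]; rewrite lee_fin b0.
  - by apply/measurable_EFinP; apply: mb => // r /=; rewrite !in_itv/= andbT => /andP[].
  - move=> r /=; rewrite in_itv/= => /andP[r0 rt]; rewrite lee_fin.
    have := bN 0 r (lexx 0) r0; rewrite add0r => /le_trans; apply.
    by rewrite ler_wpM2r ?b0// ler_expR ler_wpM2l.
rewrite integral_cst//= lebesgue_measure_itv/= lte_fin.
by case: ifP => _; rewrite -?EFinB ?mule0 -?EFinM ltry.
Qed.

(* The left Riemann sums of b are compared with its integral one step earlier. *)
Lemma monotone_gronwall t : 0 <= t ->
  ((a t)%:E <= (a 0)%:E + K%:E *
     \int[lebesgue_measure]_(r in `[0%R, t]) (b r)%:E)%E.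
Proof.
move=> t0; rewrite -/(J t) -(fineK (J_fin t t0)) -EFinM -EFinD lee_fin.
pose I t := fine (J t).
have I_step x h : 0 <= x -> 0 <= h -> h * b (x + h) <= expR (N * h) * (I (x + h) - I x).
  move=> x0 h0; have := J_step x h x0 h0.
  rewrite -(fineK (J_fin x x0)) -(fineK (J_fin (x + h) (addr_ge0 x0 h0))) -EFinD lee_fin.
  rewrite -/(I x) -/(I (x + h)) -lerBrDl => H.
  apply: le_trans (ler_wpM2l (expR_ge0 (N * h)) H).
  have E : expR (N * h) * expR (- N * h) = 1.
    by rewrite -expRD mulNr subrr expR0.
  rewrite [leRHS](_ : _ = expR (N * h) * expR (- N * h) * (h * b (x + h))).
    by rewrite E mul1r.
  by ring.
have I_ge0 x : 0 <= I x by rewrite fine_ge0.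
(* The first step has no earlier interval to be compared with, so its term in [b 0] stays apart; it
   vanishes as h tends to 0. *)
have sum h k : 0 <= h -> a (k.+1%:R * h) <= a 0 + K * h * expR (N * h) * b 0 +
    K * (expR (N * h) * expR (N * h)) * (I (k%:R * h) - I 0).
  move=> h0; elim: k => [|k IH].
    by rewrite mul1r mul0r subrr mulr0 addr0; have := ab 0 h (lexx 0) h0; rewrite add0r.
  have kh : 0 <= k%:R * h by rewrite mulr_ge0.
  have kh1 : 0 <= k.+1%:R * h by rewrite mulr_ge0.
  have -> : k.+2%:R * h = k.+1%:R * h + h by rewrite -[k.+2%:R]natr1; ring.
  have := ab _ h kh1 h0; have := I_step _ h kh h0.
  have -> : k%:R * h + h = k.+1%:R * h by rewrite -[k.+1%:R]natr1; ring.
  set bk := b (k.+1%:R * h) => H1 H2.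
  have H3 := ler_wpM2l (mulr_ge0 K0 (expR_ge0 (N * h))) H1.
  move: IH H2 H3; set e := expR (N * h); lra.
have bound h : 0 <= h -> (exists n, n.+1%:R * h = t) ->
    a t <= a 0 + K * h * expR (N * h) * b 0 +
      K * (expR (N * h) * expR (N * h)) * I t.
  move=> h0 [n nh]; have := sum h n h0; rewrite nh => /le_trans; apply.
  rewrite lerD2l ler_wpM2l//; first by rewrite mulr_ge0// mulr_ge0// expR_ge0.
  rewrite lerBlDr -[leLHS]addr0 lerD//.
  have nh0 : 0 <= n%:R * h by rewrite mulr_ge0.
  have := J_step _ h nh0 h0; have -> : n%:R * h + h = t by rewrite -nh -natr1; ring.
  move=> H; rewrite /I fine_le ?J_fin//; apply: le_trans H.
  by rewrite leeDl// lee_fin mulr_ge0 ?mulr_ge0 ?expR_ge0// b0.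
(* The bound as a continuous function of the step; it is evaluated at h = t / (n + 1), and its value
   at 0 is the claim. *)
pose g (h : R) := a 0 + K * h * expR (N * h) * b 0 +
      K * (expR (N * h) * expR (N * h)) * I t.
have gc : continuous g.
  move=> h; have : derivable g h 1 by [].
  by move/derivable1_diffP/differentiable_continuous.
have hn : (fun n : nat => t * (n.+1%:R)^-1) @ \oo --> (0 : R).
  by rewrite -(mulr0 t); apply: cvgM; [exact: cvg_cst|exact: cvg_harmonic].
have gn : (fun n : nat => g (t * (n.+1%:R)^-1)) @ \oo --> g 0.
  exact: (@cvg_comp _ _ _ _ g _ _ _ hn (gc 0)).
have -> : a 0 + K * I t = g 0 by rewrite /g !mulr0 expR0 !mul0r mulr1 addr0 mulr1.
rewrite -(cvg_lim _ gn)//; apply: limr_ge; first by apply/cvg_ex; exists (g 0).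
apply: nearW => n; apply: bound; first by rewrite mulr_ge0// invr_ge0.
by exists n; rewrite mulrCA mulfV ?mulr1.
Qed.

End MonotoneGronwall.

(** * Evolution of Wasserstein distances *)

Lemma second_differenceD (R : realType) (f g : nat -> R) m :
  second_difference (fun k => f k + g k) m =
  second_difference f m + second_difference g m.
Proof. by rewrite /second_difference; ring. Qed.

Lemma power_rem_convex (R : realType) (rho : R) m : 1 <= rho ->
  0 <= second_difference (power_rem rho) m.
Proof.
move=> r1; rewrite (second_differenceD R (fun k => k%:R)
  (fun k => if 2 < rho then k%:R `^ (rho - 1) else 0)) addr_ge0 ?natr_convex//.
have [r2|r2] := ltP 2 rho; last by rewrite /second_difference mulr0 subr0 addr0.
by apply: power_convex; lra.
Qed.

Lemma power_rem0 (R : realType) (rho : R) : power_rem rho 0 = 0.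
Proof.
by rewrite /power_rem add0r; case: ifPn => // r2; rewrite powR0// gt_eqF//; lra.
Qed.

Lemma comonotone_cost_rem (R : realType) (rho : R) (P Q : probability nat R) :
  comonotone_cost (power_rem rho) P Q =
  (wasserstein 1 P Q +
   (if (2 < rho)%R then wasserstein (rho - 1) P Q `^ (rho - 1) else 0))%E.
Proof.
rewrite wasserstein1; case: ifPn => r2; last first.
  rewrite adde0; congr comonotone_cost; apply/funext => k.
  by rewrite /power_rem (negbTE r2) addr0.
rewrite wasserstein_power; last lra.
rewrite -[X in (X + _)%E]mul1e -[X in (_ + X)%E]mul1e -comonotone_cost_lin//.
  by congr comonotone_cost; apply/funext => k; rewrite /power_rem r2 !mul1r.
Qed.

Section Main.
Context {R : realType}.
Variables (eta nu : nat -> R) (C kappa : R).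
Hypotheses (eta0 : forall x, 0 <= eta x) (nu0 : forall x, 0 <= nu x).
Hypothesis nu00 : nu 0%N = 0.
Hypotheses (C0 : 0 < C) (etaC : forall x, eta x <= C * (1 + x%:R)).
Hypothesis curv : forall x, kappa <= eta x + nu x.+1 - eta x.+1 - nu x.
Variables p p' : R -> R.-pker nat ~> nat.
Hypotheses (pS : markov_semigroup p) (pG : has_generator p (bd_generator eta nu)).
Hypotheses (pS' : markov_semigroup p') (pG' : has_generator p' (bd_generator eta nu)).
Variables mu mu' : R -> probability nat R.
Hypothesis mu_law : forall (t h : R) A, 0 <= t -> 0 <= h ->
  (mu (t + h) A = \int[mu t]_x p h x A)%E.
Hypothesis mu_law' : forall (t h : R) A, 0 <= t -> 0 <= h ->
  (mu' (t + h) A = \int[mu' t]_x p' h x A)%E.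

Let cost (phi : nat -> R) (t : R) := comonotone_cost phi (mu t) (mu' t).

Let cost_transport (phi : nat -> R) (S dS : R -> nat -> R) (t h : R) :
  phi 0%N = 0 -> (forall m, 0 <= second_difference phi m) ->
  (forall (s : R) k, is_derive s 1 (S^~ k) (dS s k)) ->
  (forall (s : R) k, 0 <= s -> 0 <= S s k) -> (forall k, phi k <= S 0 k) ->
  (forall (s : R) x y, 0 <= s ->
    coupled_generator eta nu (fun x y => S s (dist_nat x y)) x y
      <= dS s (dist_nat x y)) ->
  0 <= t -> 0 <= h -> (cost phi (t + h) <= cost (S h) t)%E.
Proof.
move=> phi0 cvx Sd S0 phiS Sgen t0 h0.
apply: (comonotone_transport eta nu C eta0 nu0 C0 etaC p p' pS pG pS' pG'
  mu mu' mu_law mu_law' phi S dS) => //.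
exact: comonotone_coupling.
Qed.

Lemma coupled_generator_lin (f g : nat -> nat -> R) (c d : R) x y :
  coupled_generator eta nu (fun x y => c * f x y + d * g x y) x y =
  c * coupled_generator eta nu f x y + d * coupled_generator eta nu g x y.
Proof. by rewrite /coupled_generator; ring. Qed.

Lemma wasserstein1_contraction (t : R) : 0 <= t ->
  (wasserstein 1 (mu t) (mu' t) <=
   wasserstein 1 (mu 0) (mu' 0) * (expR (- kappa * t))%:E)%E.
Proof.
move=> t0; rewrite !wasserstein1 muleC -comonotone_cost_scale ?expR_ge0//.
rewrite -{1 2}[t]add0r.
apply: (cost_transport (fun k => k%:R) (fun s k => expR (- kappa * s) * k%:R)
  (fun s k => - kappa * expR (- kappa * s) * k%:R)) => //.
- by move=> m; exact: natr_convex.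
- move=> s k; apply: is_derive_eq; rewrite /GRing.scale/=; ring.
- by move=> k; rewrite mulr0 expR0 mul1r.
move=> s x y s0.
have := coupled_generator_lin (fun x y => (dist_nat x y)%:R) (fun _ _ => 0)
  (expR (- kappa * s)) 0 x y.
have -> : (fun x y => expR (- kappa * s) * (dist_nat x y)%:R + 0 * 0) =
    (fun x y => expR (- kappa * s) * (dist_nat x y)%:R).
  by apply/funext => u; apply/funext => v; rewrite mul0r addr0.
move=> ->; rewrite mul0r addr0.
have := ler_wpM2l (expR_ge0 (- kappa * s))
  (coupled_generator_dist1 eta nu kappa nu0 nu00 curv x y).
lra.
Qed.

Variables (L rho : R).
Hypothesis lipL : exists l m : R, [/\ forall x, `|eta x.+1 - eta x| <= l,
  forall x, `|nu x.+1 - nu x| <= m & l + m = L].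
Hypothesis rho1 : 1 <= rho.
Hypotheses (mom : (\int[mu 0]_x (x%:R `^ rho)%:E < +oo)%E)
  (mom' : (\int[mu' 0]_x (x%:R `^ rho)%:E < +oo)%E).

Let L0 : 0 <= L.
Proof.
have [l [m [hl hm <-]]] := lipL.
by rewrite addr_ge0// (le_trans _ (hl 0%N), le_trans _ (hm 0%N)).
Qed.

Let pow (k : nat) : R := k%:R `^ rho.

Let pow0 : pow 0%N = 0.
Proof. by rewrite /pow powR0// gt_eqF// (lt_le_trans _ rho1). Qed.

Let pow_ge0 k : 0 <= pow k. Proof. exact: powR_ge0. Qed.

Let rem_ge0 k : 0 <= power_rem rho k. Proof. exact: power_rem_ge0. Qed.

Let K := power_const rho * L.

Let K0 : 0 <= K. Proof. by rewrite mulr_ge0 ?power_const_ge0. Qed.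

Let gen_pow x y :
  coupled_generator eta nu (fun x y => pow (dist_nat x y)) x y <=
  - kappa * rho * pow (dist_nat x y) + K * power_rem rho (dist_nat x y).
Proof. exact: coupled_generator_power. Qed.

(** For rho <= 2 the remainder is the distance k. In the supersolution exp (-kappa rho s) k^rho + L
    g(s) k, the derivative of [g] balances the source exp (-kappa rho s) against the contraction of
    k at rate kappa. *)
Lemma wasserstein_power_explicit (g : R -> R) (t : R) : rho <= 2 -> 1 < rho -> 0 <= t ->
  (forall s : R, is_derive s 1 g (expR (- kappa * rho * s) - kappa * g s)) ->
  (forall s : R, 0 <= s -> 0 <= g s) ->
  (wasserstein rho (mu t) (mu' t) `^ rho <=
   wasserstein rho (mu 0) (mu' 0) `^ rho * (expR (- kappa * rho * t))%:E +
   L%:E * wasserstein 1 (mu 0) (mu' 0) * (g t)%:E)%E.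
Proof.
move=> r2 r1 t0 gd g0; rewrite !wasserstein_power// wasserstein1.
have remE k : power_rem rho k = k%:R by rewrite /power_rem ltNge r2 addr0.
have constE : power_const rho = 1 by rewrite /power_const gt_eqF// r2.
rewrite muleC -muleA (muleC (comonotone_cost _ _ _)) muleA -EFinM.
rewrite -comonotone_cost_lin ?expR_ge0// ?mulr_ge0 ?g0//.
rewrite -{1 2}[t]add0r.
apply: (cost_transport pow (fun s k => expR (- kappa * rho * s) * pow k + L * g s * k%:R)
  (fun s k => - kappa * rho * expR (- kappa * rho * s) * pow k +
     L * (expR (- kappa * rho * s) - kappa * g s) * k%:R)) => //.
- by move=> m; exact: power_convex.
- move=> s k; apply: is_derive_eq; rewrite /GRing.scale/=; ring.
- by move=> s k s0; rewrite addr_ge0// ?mulr_ge0 ?expR_ge0 ?g0.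
- move=> k; rewrite mulr0 expR0 mul1r lerDl mulr_ge0// mulr_ge0// g0//.
move=> s x y s0; rewrite coupled_generator_lin.
have := gen_pow x y; rewrite /K constE mul1r remE => h1.
have h2 := coupled_generator_dist1 eta nu kappa nu0 nu00 curv x y.
have e0 := expR_ge0 (- kappa * rho * s).
have Lg : 0 <= L * g s by rewrite mulr_ge0 ?g0.
have := ler_wpM2l e0 h1; have := ler_wpM2l Lg h2.
lra.
Qed.

Let M := rem_growth kappa L rho.

Let cost_rem_growth (t h : R) : 0 <= t -> 0 <= h ->
  (cost (power_rem rho) (t + h) <= (expR (M * h))%:E * cost (power_rem rho) t)%E.
Proof.
move=> t0 h0; rewrite /cost -comonotone_cost_scale ?expR_ge0//.
apply: (cost_transport (power_rem rho) (fun s k => expR (M * s) * power_rem rho k)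
  (fun s k => M * expR (M * s) * power_rem rho k)) => //.
- exact: power_rem0.
- by move=> m; exact: power_rem_convex.
- move=> s k; apply: is_derive_eq; rewrite /GRing.scale/=; ring.
- by move=> s k s0; rewrite mulr_ge0 ?expR_ge0.
- by move=> k; rewrite mulr0 expR0 mul1r.
move=> s x y s0.
have := coupled_generator_lin (fun x y => power_rem rho (dist_nat x y)) (fun _ _ => 0)
  (expR (M * s)) 0 x y.
have -> : (fun x y => expR (M * s) * power_rem rho (dist_nat x y) + 0 * 0) =
    (fun x y => expR (M * s) * power_rem rho (dist_nat x y)).
  by apply/funext => u; apply/funext => v; rewrite mul0r addr0.
move=> ->; rewrite mul0r addr0.
have := ler_wpM2l (expR_ge0 (M * s)) (coupled_generator_rem eta nu kappa
  nu0 nu00 curv L lipL rho x y rho1).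
by rewrite -/M; lra.
Qed.

(** In the supersolution, the coefficient K s exp (M s) of the remainder absorbs both the source K
    exp (-kappa rho s), because -kappa rho <= M, and the growth of the remainder at rate M. *)
Let cost_pow_growth (t h : R) : 0 <= t -> 0 <= h ->
  (cost pow (t + h) <= (expR (- kappa * rho * h))%:E * cost pow t +
    (K * h * expR (M * h))%:E * cost (power_rem rho) t)%E.
Proof.
move=> t0 h0.
have Kh0 : 0 <= K * h * expR (M * h) by apply: mulr_ge0; rewrite ?expR_ge0// mulr_ge0.
rewrite /cost -comonotone_cost_lin ?expR_ge0//.
apply: (cost_transport pow (fun s k => expR (- kappa * rho * s) * pow k +
     K * s * expR (M * s) * power_rem rho k)
  (fun s k => - kappa * rho * expR (- kappa * rho * s) * pow k +
     K * (1 + s * M) * expR (M * s) * power_rem rho k)) => //.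
- by move=> m; exact: power_convex.
- move=> s k; apply: is_derive_eq; rewrite /GRing.scale/=; ring.
- move=> s k s0; apply: addr_ge0; first by rewrite mulr_ge0 ?expR_ge0.
  by do 2?(apply: mulr_ge0; rewrite ?expR_ge0//); exact: mulr_ge0.
- by move=> k; rewrite !mulr0 expR0 mul1r !mul0r addr0.
move=> s x y s0; rewrite coupled_generator_lin.
have h1 := ler_wpM2l (expR_ge0 (- kappa * rho * s)) (gen_pow x y).
have KsM : 0 <= K * s * expR (M * s).
  by apply: mulr_ge0; rewrite ?expR_ge0// mulr_ge0.
have h2 := ler_wpM2l KsM (coupled_generator_rem eta nu kappa
  nu0 nu00 curv L lipL rho x y rho1).
have eM : expR (- kappa * rho * s) <= expR (M * s).
  by rewrite ler_expR ler_wpM2r//; exact: rem_growth_ge lipL _ rho1.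
have h3 := ler_wpM2l (mulr_ge0 K0 (rem_ge0 (dist_nat x y))) eM.
rewrite -/M in h2; lra.
Qed.

Let cost0_fin (f : nat -> R) : (forall k, 0 <= f k) ->
  (forall k, f k <= 2 * (1 + k%:R `^ rho)) -> cost f 0 \is a fin_num.
Proof.
move=> f0 f2; rewrite ge0_fin_numE ?comonotone_cost_ge0//.
by apply: (comonotone_cost_lty f 2 rho) => //; exact: lt_le_trans rho1.
Qed.

(** Finiteness at time 0 comes from the moments, since k and k^(rho-1) are at most k^rho for k >= 1;
    the growth estimate carries it to time [t]. *)
Let cost_rem_fin (t : R) : 0 <= t -> cost (power_rem rho) t \is a fin_num.
Proof.
move=> t0; have fin0 : cost (power_rem rho) 0 \is a fin_num.
  apply: cost0_fin => // k; rewrite /power_rem.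
  have [->|k0] := posnP k.
    rewrite add0r; case: ifPn => r2; last by rewrite mulr_ge0// addr_ge0// powR_ge0.
    by rewrite powR0 ?mulr_ge0 ?addr_ge0 ?powR_ge0// gt_eqF//; lra.
  have k1 : 1 <= k%:R :> R by rewrite ler1n.
  have h1 : k%:R <= k%:R `^ rho :> R by exact: le1r_powR.
  have h2 : k%:R `^ (rho - 1) <= k%:R `^ rho :> R by rewrite ler_powR// gerBl.
  by case: ifPn => _; lra.
rewrite ge0_fin_numE ?comonotone_cost_ge0//.
have := cost_rem_growth 0 t (lexx 0) t0; rewrite add0r => /le_lt_trans; apply.
by rewrite -(fineK fin0) -EFinM ltry.
Qed.

Let cost_pow_fin (t : R) : 0 <= t -> cost pow t \is a fin_num.
Proof.
move=> t0; have fin0 : cost pow 0 \is a fin_num.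
  by apply: cost0_fin => // k; have := pow_ge0 k; rewrite /pow; lra.
rewrite ge0_fin_numE ?comonotone_cost_ge0//.
have := cost_pow_growth 0 t (lexx 0) t0; rewrite add0r => /le_lt_trans; apply.
by rewrite -(fineK fin0) -(fineK (cost_rem_fin 0 (lexx 0))) -!EFinM -EFinD ltry.
Qed.

Lemma wasserstein_power_integral (t : R) : 0 <= t ->
  (wasserstein rho (mu t) (mu' t) `^ rho <=
   wasserstein rho (mu 0) (mu' 0) `^ rho * (expR (- kappa * rho * t))%:E +
   (power_const rho)%:E * L%:E * \int[lebesgue_measure]_(r in `[0%R, t])
     ((expR (kappa * rho * (r - t)))%:E *
      (wasserstein 1 (mu r) (mu' r) +
       (if (2 < rho)%R then wasserstein (rho - 1) (mu r) (mu' r) `^ (rho - 1)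
        else 0))))%E.
Proof.
move=> t0; rewrite !wasserstein_power//.
pose c r := fine (cost pow r); pose D r := fine (cost (power_rem rho) r).
have cE r : 0 <= r -> cost pow r = (c r)%:E by move=> r0; rewrite fineK// cost_pow_fin.
have DE r : 0 <= r -> cost (power_rem rho) r = (D r)%:E.
  by move=> r0; rewrite fineK// cost_rem_fin.
rewrite -/(cost pow t) -/(cost pow 0) !cE// -EFinM.
have -> : (\int[lebesgue_measure]_(r in `[0%R, t])
     ((expR (kappa * rho * (r - t)))%:E *
      (wasserstein 1 (mu r) (mu' r) +
       (if (2 < rho)%R then wasserstein (rho - 1) (mu r) (mu' r) `^ (rho - 1)
        else 0))) = \int[lebesgue_measure]_(r in `[0%R, t])
     (expR (kappa * rho * (r - t)) * D r)%:E)%E.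
  apply: eq_integral => r; rewrite inE/= in_itv/= => /andP[r0 _].
  by rewrite -comonotone_cost_rem -/(cost _ r) DE.
(* The integrating factor cancels the exponential in the one-step estimate for [c] and shifts the
   growth rate of the remainder from M to M + kappa rho, which is nonnegative by [rem_growth_ge]. *)
pose a r := expR (kappa * rho * (r - t)) * c r.
pose b r := expR (kappa * rho * (r - t)) * D r.
have -> : (c t)%:E = (a t)%:E by rewrite /a subrr mulr0 expR0 mul1r.
have -> : (c 0 * expR (- kappa * rho * t))%:E = (a 0)%:E.
  by rewrite /a sub0r mulrC; congr (expR _ * _)%:E; ring.
rewrite -EFinM -/K.
apply: (monotone_gronwall a b K (M + kappa * rho)) => //.
- by have := rem_growth_ge eta nu kappa L lipL rho rho1; rewrite -/M; lra.
- by move=> r r0; rewrite /b mulr_ge0 ?expR_ge0// fine_ge0// comonotone_cost_ge0.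
- move=> r h r0 h0; have := cost_rem_growth r h r0 h0.
  rewrite DE ?addr_ge0// DE// -EFinM lee_fin => H.
  rewrite /b; apply: le_trans (ler_wpM2l (expR_ge0 _) H) _.
  rewrite !mulrA -!expRD le_eqVlt; apply/orP; left; apply/eqP.
  by congr (expR _ * _); ring.
- move=> r h r0 h0; have := cost_pow_growth r h r0 h0.
  rewrite cE ?addr_ge0// cE// DE// -!EFinM -EFinD lee_fin => H.
  rewrite /a /b; apply: le_trans (ler_wpM2l (expR_ge0 _) H) _.
  set u := expR (kappa * rho * (r + h - t)); set D0 := D r.
  have -> : expR (kappa * rho * (r - t)) = u * expR (- kappa * rho * h).
    by rewrite -expRD; congr expR; ring.
  have -> : expR ((M + kappa * rho) * h) = expR (kappa * rho * h) * expR (M * h).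
    by rewrite -expRD; congr expR; ring.
  have E : expR (kappa * rho * h) * expR (- kappa * rho * h) = 1.
    by rewrite -expRD -expR0; congr expR; ring.
  rewrite le_eqVlt; apply/orP; left; apply/eqP.
  transitivity (u * expR (- kappa * rho * h) * c r +
    K * h * expR (M * h) * (u * (expR (kappa * rho * h) * expR (- kappa * rho * h))) * D0).
    by rewrite E; ring.
  by ring.
Qed.

End Main.

(** * Finite curvature and Lipschitz constants *)

Section Rates.
Context {R : realType}.
Variables eta nu : nat -> R.

Lemma bd_curvature_le x : (-oo < bd_curvature eta nu)%E ->
  fine (bd_curvature eta nu) <= eta x + nu x.+1 - eta x.+1 - nu x.
Proof.
move=> kNy; have le y : (bd_curvature eta nu <= (eta y + nu y.+1 - eta y.+1 - nu y)%:E)%E.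
  by apply: ereal_inf_lbound; exists y.
rewrite -lee_fin fineK// fin_real// kNy.
by rewrite (le_lt_trans (le 0%N))// ltry.
Qed.

Lemma bd_lip_ge0 (g : nat -> R) : (0 <= bd_lip g)%E.
Proof.
apply: (@le_trans _ _ (`|g 1%N - g 0%N|%:E)%E); first by rewrite lee_fin.
by apply: ereal_sup_ubound; exists 0%N.
Qed.

Lemma le_bd_lip (g : nat -> R) x : (bd_lip g < +oo)%E ->
  `|g x.+1 - g x| <= fine (bd_lip g).
Proof.
move=> gy; rewrite -lee_fin fineK ?ge0_fin_numE ?bd_lip_ge0//.
by apply: ereal_sup_ubound; exists x.
Qed.

Lemma bd_lip_split : (bd_lip eta + bd_lip nu < +oo)%E ->
  exists L : R, (bd_lip eta + bd_lip nu = L%:E)%E /\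
  exists l m : R, [/\ forall x, `|eta x.+1 - eta x| <= l,
    forall x, `|nu x.+1 - nu x| <= m & l + m = L].
Proof.
move=> sy; have e0 := bd_lip_ge0 eta; have n0 := bd_lip_ge0 nu.
have ey : (bd_lip eta < +oo)%E by apply: le_lt_trans sy; rewrite leeDl.
have ny : (bd_lip nu < +oo)%E by apply: le_lt_trans sy; rewrite leeDr.
exists (fine (bd_lip eta) + fine (bd_lip nu)); split.
  by rewrite EFinD !fineK ?ge0_fin_numE.
exists (fine (bd_lip eta)), (fine (bd_lip nu)); split=> // x; exact: le_bd_lip.
Qed.

End Rates.

Lemma moment_distribution d (Om : measurableType d) (R : realType)
    (P : probability Om R) (X : {RV P >-> nat}) (rho : R) :
  ('E_P[(fun w => (X w)%:R `^ rho)%R] =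
   \int[distribution P X]_x (x%:R `^ rho)%:E)%E.
Proof.
by rewrite unlock ge0_integral_distribution.
Qed.

(** * The explicit time factor for exponents in (1, 2] *)

Section ExponentialQuotient.
Context {R : realType}.
Variables kappa rho : R.
Hypothesis rho1 : 1 < rho.

(** The solution of g' + kappa g = exp (-kappa rho s) with g(0) = 0, that is, the integral over r in
    [0, t] of exp (-kappa (t - r)) exp (-kappa rho r). *)
Definition exp_quotient (t : R) : R :=
  if kappa == 0 then t
  else (expR (- kappa * t) - expR (- kappa * rho * t)) / (kappa * (rho - 1)).

Lemma exp_quotient_derive (s : R) : is_derive s 1 exp_quotient
  (expR (- kappa * rho * s) - kappa * exp_quotient s).
Proof.
rewrite /exp_quotient; have [->|k0] := eqVneq kappa 0.
  by apply: is_derive_eq; rewrite oppr0 !mul0r expR0 subr0.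
apply: is_derive_eq; rewrite /GRing.scale/=.
by field; rewrite k0 subr_eq0 gt_eqF.
Qed.

(** Numerator and denominator both have the sign of kappa. The exponential factored out depends on
    this sign, so that the remaining exponent u is nonnegative and exp u - 1 >= u >= 0 applies. *)
Lemma exp_quotient_ge0 (s : R) : 0 <= s -> 0 <= exp_quotient s.
Proof.
move=> s0; rewrite /exp_quotient; case: eqVneq => // k0.
have r0 : 0 < rho - 1 by rewrite subr_gt0.
have le (x : R) : x * (rho - 1) * s <= expR (x * (rho - 1) * s) - 1.
  by rewrite lerBrDl expR_ge1Dx.
have E : expR (- kappa * s) - expR (- kappa * rho * s) =
    expR (- kappa * rho * s) * (expR (kappa * (rho - 1) * s) - 1).
  by rewrite mulrBr mulr1 -expRD; congr (expR _ - _); ring.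
have E' : expR (- kappa * s) - expR (- kappa * rho * s) =
    - (expR (- kappa * s) * (expR (- kappa * (rho - 1) * s) - 1)).
  by rewrite mulrBr mulr1 -expRD opprB; congr (_ - expR _); ring.
have [kpos|kneg] := ltP 0 kappa.
  rewrite divr_ge0 ?mulr_ge0 ?(ltW kpos) ?(ltW r0)// E mulr_ge0 ?expR_ge0//.
  by rewrite (le_trans _ (le _))// !mulr_ge0 ?(ltW kpos) ?(ltW r0).
apply: mulr_le0; last by rewrite invr_le0 mulr_le0_ge0// ltW.
rewrite E' oppr_le0 mulr_ge0 ?expR_ge0// (le_trans _ (le _))//.
by rewrite !mulr_ge0 ?oppr_ge0 ?(ltW r0).
Qed.

End ExponentialQuotient.

Theorem theorem4p2 (R : realType) :
  exists Crho : R -> R,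
    [/\ (forall rho : R, 1 <= rho -> 0 <= Crho rho),
        Crho 1 = 0,
        (forall rho : R, 1 < rho -> rho <= 2 -> Crho rho = 1)
      & forall (eta nu : nat -> R) (rho : R)
          (d d' : measure_display)
          (Om : measurableType d) (Om' : measurableType d')
          (P : probability Om R) (P' : probability Om' R)
          (X : R -> {RV P >-> nat}) (X' : R -> {RV P' >-> nat}),
        (forall x, 0 <= eta x) -> (forall x, 0 <= nu x) -> nu 0%N = 0 ->
        (exists C : R, 0 < C /\ forall x : nat, eta x <= C * (1 + x%:R)) ->
        birth_death_process eta nu X ->
        birth_death_process eta nu X' ->
        (-oo < bd_curvature eta nu)%E ->
        1 <= rho ->
        ('E_P[(fun w => (X 0 w)%:R `^ rho)%R] +
          'E_P'[(fun w => (X' 0 w)%:R `^ rho)%R] < +oo)%E ->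
        let kappa : R := fine (bd_curvature eta nu) in
        let W (q t : R) : \bar R :=
          wasserstein q (distribution P (X t)) (distribution P' (X' t)) in
        let Lips : \bar R := (bd_lip eta + bd_lip nu)%E in
        (forall t : R, 0 <= t ->
           (W 1%R t <= W 1%R 0%R * (expR (- kappa * t))%:E)%E) /\
        ((Lips < +oo)%E ->
           (forall t : R, 0 <= t ->
              (W rho t `^ rho <=
                 W rho 0%R `^ rho * (expR (- kappa * rho * t))%:E
                 + (Crho rho)%:E * Lips *
                   \int[lebesgue_measure]_(r in `[0%R, t])
                     ((expR (kappa * rho * (r - t)))%:E *
                      (W 1%R r + (if (2 < rho)%R
                                  then W (rho - 1)%R r `^ (rho - 1)
                                  else 0))))%E) /\
           (1 < rho -> rho <= 2 -> forall t : R, 0 <= t ->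
              (W rho t `^ rho <=
                 W rho 0%R `^ rho * (expR (- kappa * rho * t))%:E
                 + Lips * W 1%R 0%R *
                   (if kappa == 0%R then t
                    else (expR (- kappa * t) - expR (- kappa * rho * t)) /
                         (kappa * (rho - 1)))%:E)%E))].
Proof.
exists power_const; split.
- by move=> rho r1; exact: power_const_ge0.
- by rewrite /power_const eqxx.
- by move=> rho r1 r2; rewrite /power_const gt_eqF// r2.
move=> eta nu rho d d' Om Om' P P' X X' eta0 nu0 nu00 [C [C0 etaC]].
move=> [_ [p [pS pG Xp]]] [_ [p' [pS' pG' Xp']]] kNy r1 mom kappa W Lips.
have curv x : kappa <= eta x + nu x.+1 - eta x.+1 - nu x by exact: bd_curvature_le.
have law (t h : R) A : 0 <= t -> 0 <= h -> (distribution P (X (t + h)%R) A =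
    \int[distribution P (X t)]_x p h x A)%E by exact: markov_law.
have law' (t h : R) A : 0 <= t -> 0 <= h -> (distribution P' (X' (t + h)%R) A =
    \int[distribution P' (X' t)]_x p' h x A)%E by exact: markov_law.
pose mu t : probability nat R := distribution P (X t).
pose mu' t : probability nat R := distribution P' (X' t).
have m0 (mu0 : probability nat R) : (0 <= \int[mu0]_x (x%:R `^ rho)%:E)%E.
  by apply: integral_ge0 => x _; rewrite lee_fin powR_ge0.
rewrite !moment_distribution in mom.
have mX : (\int[mu 0%R]_x (x%:R `^ rho)%:E < +oo)%E.
  by apply: le_lt_trans mom; rewrite leeDl.
have mX' : (\int[mu' 0%R]_x (x%:R `^ rho)%:E < +oo)%E.
  by apply: le_lt_trans mom; rewrite leeDr.
split=> [t t0|].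
  exact: (wasserstein1_contraction eta nu C kappa eta0 nu0 nu00 C0 etaC curv
    p p' pS pG pS' pG' mu mu' law law').
move=> /bd_lip_split[L [LE lipL]]; rewrite /Lips LE; split=> [t t0|r1' r2 t t0].
  exact: (wasserstein_power_integral eta nu C kappa eta0 nu0 nu00 C0 etaC curv
    p p' pS pG pS' pG' mu mu' law law' L rho lipL).
apply: (wasserstein_power_explicit eta nu C kappa eta0 nu0 nu00 C0 etaC curv
    p p' pS pG pS' pG' mu mu' law law' L rho lipL _ (exp_quotient kappa rho)) => //.
- by move=> s; exact: exp_quotient_derive.
- by move=> s; exact: exp_quotient_ge0.
Qed.
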